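(* Let $(\mathfrak W_1,\mathfrak V_1)$ and $(\mathfrak W_2,\mathfrak V_2)$ be AVWCs. 1. If $C_{\mathrm S}(\mathfrak W_1,\mathfrak V_1)=C_{\mathrm S}(\mathfrak W_2,\mathfrak V_2)=0$, then $C_{\mathrm S}(\mathfrak W_1\otimes\mathfrak W_2,\mathfrak V_1\otimes\mathfrak V_2)>0$ holds if and only if $\mathfrak W_1\otimes\mathfrak W_2$ is not symmetrizable and $C^{\mathrm{mean}}_{\mathrm{S,ran}}(\mathfrak W_1\otimes\mathfrak W_2,\mathfrak V_1\otimes\mathfrak V_2)>0$. If $C_{\mathrm S}$ shows super-activation for these two AVWCs, then $C_{\mathrm S}(\mathfrak W_1\otimes\mathfrak W_2,\mathfrak V_1\otimes\mathfrak V_2)=C^{\mathrm{mean}}_{\mathrm{S,ran}}(\mathfrak W_1\otimes\mathfrak W_2,\mathfrak V_1\otimes\mathfrak V_2)$. 2. There exist AVWCs for which $C_{\mathrm S}$ shows super-activation. 3. If $C^{\mathrm{mean}}_{\mathrm{S,ran}}$ shows super-activation for $(\mathfrak W_1,\mathfrak V_1)$ and $(\mathfrak W_2,\mathfrak V_2)$, then $C_{\mathrm S}$ shows super-activation for them if and only if at least one of $\mathfrak W_1,\mathfrak W_2$ is non-symmetrizable. 4. If $C^{\mathrm{mean}}_{\mathrm{S,ran}}$ shows no super-activation for $(\mathfrak W_1,\mathfrak V_1)$ and $(\mathfrak W_2,\mathfrak V_2)$, then super-activation of $C_{\mathrm S}$ can only happen if (up to swapping the labels 1 and 2) $\mathfrak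 W_1$ is non-symmetrizable, $\mathfrak W_2$ is symmetrizable, $C^{\mathrm{mean}}_{\mathrm{S,ran}}(\mathfrak W_1,\mathfrak V_1)=0$ and $C^{\mathrm{mean}}_{\mathrm{S,ran}}(\mathfrak W_2,\mathfrak V_2)>0$.
   Context: All alphabets are finite; logs base 2; $C(\mathcal A,\mathcal B)$ denotes channels. An AVWC $(\mathfrak W,\mathfrak V)$: channels $W_s\in C(\mathcal X,\mathcal Y)$ (to Bob), $V_s\in C(\mathcal X,\mathcal Z)$ (to Eve), $s$ in a finite state set $\mathcal S$; $W_{s^n}=W_{s_1}\otimes\cdots\otimes W_{s_n}$, $V_{s^n}$ likewise. $\mathfrak W=(W_s)_s$ is symmetrizable if there is $U\in C(\mathcal X,\mathcal S)$ with $\sum_su(s|x)w_s(y|x')=\sum_su(s|x')w_s(y|x)$ for all $x,x',y$. Joint use: taking (without loss of generality) a common state set $\mathcal S$, $(\mathfrak W_1\otimes\mathfrak W_2,\mathfrak V_1\otimes\mathfrak V_2)$ is the AVWC with input $\mathcal X_1\times\mathcal X_2$, outputs $\mathcal Y_1\times\mathcal Y_2$ and $\mathcal Z_1\times\mathcal Z_2$, state set $\mathcal S\times\mathcal S$, and channels $W_{1,s}\otimes W_{2,s'}$, $V_{1,s}\otimes V_{2,s'}$. A common randomness assisted code of blocklength $n$: $K,\Gamma\in\mathbb N$, stochastic encoders $e^\gamma\in C([K],\mathcal X^n)$, sets $D^\gamma_k\subset\mathcal Y^n$ disjoint in $k$; error $1-\min_{s^n}\frac1{K\Gamma}\sum_{k,\gamma}\sum_{x^n}e^\gamma(x^n|k)w_{s^n}(D^\gamma_k|x^n)$;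 $\mathfrak K$ uniform on $[K]$, independent $\mathfrak\Gamma$ uniform on $[\Gamma]$, Eve's output $\mathfrak Z_{s^n}\sim V_{s^n}(\cdot|x^n)$ with $x^n\sim e^\gamma(\cdot|k)$. $C_{\mathrm S}$ is the supremum of $R$ achievable with $\Gamma_n=1$, error $\to0$, $\liminf\frac1n\log K_n=R$ and $\limsup_n\max_{s^n}I(\mathfrak K_n;\mathfrak Z_{s^n})=0$; $C^{\mathrm{mean}}_{\mathrm{S,ran}}$ is the same with arbitrary $\Gamma_n$ and secrecy condition $\limsup_n\max_{s^n}I(\mathfrak K_n;\mathfrak Z_{s^n}|\mathfrak\Gamma_n)=0$. A capacity $C$ shows super-activation for two AVWCs if $C(\mathfrak W_1,\mathfrak V_1)=C(\mathfrak W_2,\mathfrak V_2)=0$ but $C(\mathfrak W_1\otimes\mathfrak W_2,\mathfrak V_1\otimes\mathfrak V_2)>0$. *)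

(* Defs.v *)
From HB Require Import structures.
From mathcomp Require Import all_boot all_order all_algebra.
From mathcomp Require Import all_classical all_reals all_analysis.
Set Implicit Arguments.
Unset Strict Implicit.
Unset Printing Implicit Defensive.
Import Order.TTheory GRing.Theory Num.Theory.
Local Open Scope ring_scope.
Import numFieldNormedType.Exports.

Section AVWC.
Variable R : realType.

Definition log2 (x : R) : R := ln x / ln 2.

Definition is_channel (A B : finType) (W : A -> B -> R) : Prop :=
  (forall a b, 0 <= W a b) /\ (forall a, \sum_(b : B) W a b = 1).

(* An arbitrarily varying wiretap channel: finite (nonempty) alphabets and
   finite nonempty state set; W s : channel to Bob, V s : channel to Eve. *)
Record AVWC := MkAVWC {
  avX : finType; avY : finType; avZ : finType; avS : finType;
  avX_inh : avX;
  avS_inh : avS;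
  avW : avS -> avX -> avY -> R;
  avV : avS -> avX -> avZ -> R;
  avW_ch : forall s, is_channel (avW s);
  avV_ch : forall s, is_channel (avV s) }.

Lemma prod_channel (A1 B1 A2 B2 : finType) (W1 : A1 -> B1 -> R) (W2 : A2 -> B2 -> R) :
  is_channel W1 -> is_channel W2 ->
  is_channel (fun (a : A1 * A2) (b : B1 * B2) => W1 a.1 b.1 * W2 a.2 b.2).
Proof.
move=> [p1 s1] [p2 s2]; split=> [a b|a]; first by rewrite mulr_ge0.
rewrite -(pair_bigA _ (fun b1 b2 => W1 a.1 b1 * W2 a.2 b2)) /=.
under eq_bigr do rewrite -mulr_sumr s2 mulr1.
exact: s1.
Qed.

Definition avwc_prod (A1 A2 : AVWC) : AVWC :=
  @MkAVWC (avX A1 * avX A2)%type (avY A1 * avY A2)%type (avZ A1 * avZ A2)%type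
    (avS A1 * avS A2)%type (avX_inh A1, avX_inh A2) (avS_inh A1, avS_inh A2)
    (fun s x y => avW s.1 x.1 y.1 * avW s.2 x.2 y.2)
    (fun s x z => avV s.1 x.1 z.1 * avV s.2 x.2 z.2)
    (fun s => prod_channel (avW_ch s.1) (avW_ch s.2))
    (fun s => prod_channel (avV_ch s.1) (avV_ch s.2)).

Definition symmetrizable (A : AVWC) : Prop :=
  exists U : avX A -> avS A -> R, is_channel U /\
    forall (x x' : avX A) (y : avY A),
      \sum_(s : avS A) U x s * avW s x' y = \sum_(s : avS A) U x' s * avW s x y.

Definition nW (A : AVWC) (n : nat) (sn : {ffun 'I_n -> avS A})
  (xn : {ffun 'I_n -> avX A}) (yn : {ffun 'I_n -> avY A}) : R :=
  \prod_(i < n) avW (sn i) (xn i) (yn i).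
Definition nV (A : AVWC) (n : nat) (sn : {ffun 'I_n -> avS A})
  (xn : {ffun 'I_n -> avX A}) (zn : {ffun 'I_n -> avZ A}) : R :=
  \prod_(i < n) avV (sn i) (xn i) (zn i).

(* Common randomness assisted code of blocklength n: messages 'I_K (= [K]),
   common randomness 'I_G (= [Gamma]), stochastic encoders e^gamma in
   C([K], X^n), decoding sets D^gamma_k disjoint in k. *)
Record code (A : AVWC) (n : nat) := MkCode {
  cK : nat; cG : nat;
  cK_gt0 : (0 < cK)%N; cG_gt0 : (0 < cG)%N;
  cE : 'I_cG -> 'I_cK -> {ffun 'I_n -> avX A} -> R;
  cE_ch : forall g, is_channel (cE g);
  cD : 'I_cG -> 'I_cK -> {set {ffun 'I_n -> avY A}};
  cD_disj : forall g k k', k != k' -> [disjoint cD g k & cD g k'] }.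

Definition success (A : AVWC) (n : nat) (c : code A n) (sn : {ffun 'I_n -> avS A}) : R :=
  (cK c * cG c)%:R^-1 *
  \sum_(g : 'I_(cG c)) \sum_(k : 'I_(cK c)) \sum_(xn : {ffun 'I_n -> avX A})
     cE g k xn * \sum_(yn in cD g k) nW sn xn yn.

Definition error (A : AVWC) (n : nat) (c : code A n) : R :=
  \big[Num.max/0]_(sn : {ffun 'I_n -> avS A}) (1 - success c sn).

Definition jointKGZ (A : AVWC) (n : nat) (c : code A n) (sn : {ffun 'I_n -> avS A})
  (k : 'I_(cK c)) (g : 'I_(cG c)) (zn : {ffun 'I_n -> avZ A}) : R :=
  (cK c * cG c)%:R^-1 * \sum_(xn : {ffun 'I_n -> avX A}) cE g k xn * nV sn xn zn.

Definition MI (TA TB : finType) (P : TA -> TB -> R) : R :=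
  \sum_(a : TA) \sum_(b : TB)
     P a b * log2 (P a b / ((\sum_(b' : TB) P a b') * (\sum_(a' : TA) P a' b))).

Definition CMI (TA TB TC : finType) (P : TA -> TB -> TC -> R) : R :=
  \sum_(a : TA) \sum_(b : TB) \sum_(c : TC)
     P a b c * log2 (P a b c * (\sum_(a' : TA) \sum_(b' : TB) P a' b' c) /
                     ((\sum_(b' : TB) P a b' c) * (\sum_(a' : TA) P a' b c))).

Definition leakMI (A : AVWC) (n : nat) (c : code A n) (sn : {ffun 'I_n -> avS A}) : R :=
  MI (fun (k : 'I_(cK c)) (zn : {ffun 'I_n -> avZ A}) =>
        \sum_(g : 'I_(cG c)) @jointKGZ A n c sn k g zn).

Definition leakCMI (A : AVWC) (n : nat) (c : code A n) (sn : {ffun 'I_n -> avS A}) : R :=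
  CMI (fun (k : 'I_(cK c)) (zn : {ffun 'I_n -> avZ A}) (g : 'I_(cG c)) =>
        @jointKGZ A n c sn k g zn).

Definition max_leakMI (A : AVWC) (n : nat) (c : code A n) : R :=
  \big[Num.max/0]_(sn : {ffun 'I_n -> avS A}) leakMI c sn.
Definition max_leakCMI (A : AVWC) (n : nat) (c : code A n) : R :=
  \big[Num.max/0]_(sn : {ffun 'I_n -> avS A}) leakCMI c sn.

Definition rate_of (A : AVWC) (c : forall n, code A n) : \bar R :=
  limn_einf (fun n => (log2 (cK (c n))%:R / n%:R)%:E).

Definition achievable_S (A : AVWC) (r : R) : Prop :=
  exists c : forall n, code A n,
    (forall n, cG (c n) = 1%N) /\
    ((fun n => error (c n)) @ \oo --> (0 : R))%classic /\
    rate_of c = r%:E /\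
    limn_esup (fun n => (max_leakMI (c n))%:E) = 0%E.

Definition achievable_Sran (A : AVWC) (r : R) : Prop :=
  exists c : forall n, code A n,
    ((fun n => error (c n)) @ \oo --> (0 : R))%classic /\
    rate_of c = r%:E /\
    limn_esup (fun n => (max_leakCMI (c n))%:E) = 0%E.

Definition C_S (A : AVWC) : \bar R := ereal_sup [set r%:E | r in achievable_S A]%classic.
Definition C_Sran_mean (A : AVWC) : \bar R :=
  ereal_sup [set r%:E | r in achievable_Sran A]%classic.

Definition superactivates (C : AVWC -> \bar R) (A1 A2 : AVWC) : Prop :=
  C A1 = 0%E /\ C A2 = 0%E /\ (0 < C (avwc_prod A1 A2))%E.

End AVWC.

(* Main.v *)
Require Import Defs.
From HB Require Import structures.
From mathcomp Require Import all_boot all_order all_algebra.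
From mathcomp Require Import all_classical all_reals all_analysis.
From mathcomp Require Import ring lra zify.
Set Implicit Arguments.
Unset Strict Implicit.
Unset Printing Implicit Defensive.
Import Order.TTheory GRing.Theory Num.Theory.
Import numFieldNormedType.Exports.
Local Open Scope ring_scope.

(** All four parts follow from two facts about a single AVWC, together with the
    remark that a product is symmetrizable iff both factors are.

    (a) If [W] is symmetrizable, an adversary who feeds the symmetrizing channel
    with the codeword of an independent random message makes the two messages
    indistinguishable, so uncorrelated codes with at least two messages have
    error at least 1/4 and [C_S = 0].

    (b) If [W] is not symmetrizable, then [C_S = C_Sran_mean].  A Chernoff bound
    replaces the common randomness of a code of blocklength [N] by a uniform
    choice among at least [N ^ 4] of its values, without spoiling error or
    leakage; the sampled value is announced to Bob (and to Eve, harmlessly) by a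
    public prefix of length [o(N)].  The prefix consists of blocks of length
    [#|X| ^ K], each carrying one of [K] messages: time runs over all words
    [t] in [X ^ K], and message [i] sends the letter [t i] at time [t].  These
    codewords behave exactly like independent uniform ones, so by Bessel's
    inequality a state sequence can be correlated with boundedly many of them
    only; for all other messages the joint statistics of the output with any two
    codewords identify the message, since confusion of two messages would yield
    an approximately symmetrizing channel.

    Super-activation occurs for a noiseless bit that Eve overhears combined with
    the adder channel [y = x + s], which Eve does not see: the former is not
    symmetrizable and the latter has positive random-code secrecy capacity. *)

(** * Information inequalities *)

Section Information.
Variable R : realType.
Implicit Types (p q c x : R).

Lemma ln2_gt0 : 0 < ln (2 : R).
Proof. by apply: ln_gt0; lra. Qed.

Lemma log2_ge0 x : 1 <= x -> 0 <= log2 x.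
Proof. by move=> x1; apply: divr_ge0; [exact: ln_ge0|exact/ltW/ln2_gt0]. Qed.

Lemma ler_log2 x y : 0 < x -> x <= y -> log2 x <= log2 y.
Proof.
move=> x0 xy; rewrite ler_pM2r ?invr_gt0 ?ln2_gt0 // ler_ln // posrE //.
exact: lt_le_trans xy.
Qed.

Lemma ln_ge_1BV x : 0 < x -> 1 - x^-1 <= ln x.
Proof.
move=> x0; rewrite -[x in ln x]invrK lnV ?posrE ?invr_gt0 // lerNr opprB.
have := @le_ln1Dx R (x^-1 - 1); rewrite addrCA subrr addr0; apply.
by rewrite ltrBDr addNr invr_gt0.
Qed.

(* The convex function [p ln (p / q)] lies above its tangent plane along [p = c q]. *)
Lemma plnpq_tangent p q c : 0 <= p -> 0 <= q -> (q = 0 -> p = 0) -> 0 < c ->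
  p * ln c + p - c * q <= p * ln (p / q).
Proof.
move=> p0 q0 qp c0; have [pz|pn] := eqVneq p 0.
  by rewrite pz !mul0r !add0r oppr_le0 mulr_ge0 // ltW.
have p0' : 0 < p by rewrite lt_def pn.
have q0' : 0 < q by rewrite lt_def q0 andbT; apply: contra_neq pn.
have -> : ln (p / q) = ln c + ln (p / q / c).
  by rewrite -lnM ?posrE ?divr_gt0 //; congr ln; field; rewrite !gt_eqF.
rewrite mulrDr -addrA lerD2l.
have := ln_ge_1BV (divr_gt0 (divr_gt0 p0' q0') c0).
rewrite -(ler_pM2l p0'); apply: le_trans.
by rewrite le_eqVlt; apply/orP; left; apply/eqP; field; rewrite !gt_eqF.
Qed.

(** Sum the tangent bound over [i] with slope [c] equal to the ratio of the totals: the linear terms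
    then cancel. *)
Lemma log_sum (I : finType) (p q : I -> R) :
  (forall i, 0 <= p i) -> (forall i, 0 <= q i) -> (forall i, q i = 0 -> p i = 0) ->
  (\sum_i p i) * ln ((\sum_i p i) / (\sum_i q i)) <= \sum_i p i * ln (p i / q i).
Proof.
move=> p0 q0 qp; have P0 : 0 <= \sum_i p i by exact: sumr_ge0.
have Q0 : 0 <= \sum_i q i by exact: sumr_ge0.
have [pz|pn] := eqVneq (\sum_i p i) 0.
  have pi0 i : p i = 0.
    by move/eqP: pz; rewrite psumr_eq0 // => /allP/(_ i (mem_index_enum i))/eqP.
  by rewrite pz mul0r big1 // => i _; rewrite pi0 mul0r.
have Pp : 0 < \sum_i p i by rewrite lt_def pn.
have Qp : 0 < \sum_i q i.
  rewrite lt_def Q0 andbT; apply: contra_neq pn => qz; apply: big1 => i _; apply: qp.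
  by move/eqP: qz; rewrite psumr_eq0 // => /allP/(_ i (mem_index_enum i))/eqP.
set c := _ / _; have c0 : 0 < c by rewrite divr_gt0.
apply: le_trans (ler_sum _ (fun i _ => plnpq_tangent (p0 i) (q0 i) (qp i) c0)).
rewrite sumrB big_split /= -mulr_suml -mulr_sumr.
by rewrite {3}/c divfK ?gt_eqF // addrK.
Qed.

Section MutualInformation.
Variables TA TB : finType.
Variable P : TA -> TB -> R.
Hypothesis P0 : forall a b, 0 <= P a b.

Lemma MI_ln2 : MI P * ln 2 = \sum_a \sum_b
  P a b * ln (P a b / ((\sum_b' P a b') * (\sum_a' P a' b))).
Proof.
rewrite /MI mulr_suml; apply: eq_bigr => a _; rewrite mulr_suml; apply: eq_bigr => b _.
by rewrite /log2 mulrA divfK // gt_eqF // ln2_gt0.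
Qed.

Lemma joint_le_marg1 a b : P a b <= \sum_b' P a b'.
Proof. by rewrite (bigD1 b) //= lerDl sumr_ge0. Qed.

Lemma joint_le_marg2 a b : P a b <= \sum_a' P a' b.
Proof. by rewrite (bigD1 a) //= lerDl sumr_ge0. Qed.

(** A variational lower bound with a free test function [c]: the constant 1 gives nonnegativity, and
    a function adapted to decoding sets gives a Fano-type bound. *)
Lemma MI_tangent (c : TA -> TB -> R) : (forall a b, 0 < c a b) ->
  \sum_a \sum_b (P a b * ln (c a b) + P a b
                 - c a b * ((\sum_b' P a b') * (\sum_a' P a' b))) <= MI P * ln 2.
Proof.
move=> c0; rewrite MI_ln2; apply: ler_sum => a _; apply: ler_sum => b _.
apply: plnpq_tangent => //; first by rewrite mulr_ge0 // sumr_ge0.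
move/eqP; rewrite mulf_eq0 => /orP[] /eqP z; apply/eqP; rewrite eq_le P0 andbT -z.
  exact: joint_le_marg1.
exact: joint_le_marg2.
Qed.

Lemma sum_marginals : \sum_a \sum_b P a b = 1 ->
  \sum_a \sum_b ((\sum_b' P a b') * (\sum_a' P a' b)) = 1.
Proof.
move=> P1; under eq_bigr => a _ do rewrite -mulr_sumr.
by rewrite -mulr_suml P1 mul1r exchange_big.
Qed.

Lemma MI_ge0 : \sum_a \sum_b P a b = 1 -> 0 <= MI P.
Proof.
move=> P1; rewrite -(pmulr_lge0 _ ln2_gt0).
apply: le_trans (MI_tangent (c := fun _ _ => 1) (fun _ _ => ltr01)).
under eq_bigr => a _ do under eq_bigr => b _ do rewrite ln1 mulr0 add0r mul1r.
under eq_bigr => a _ do rewrite sumrB.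
by rewrite sumrB P1 sum_marginals // subrr.
Qed.

(** A joint mass never exceeds its marginal in [b], so with uniform [a] every ratio inside the
    logarithm is at most [#|TA|]. *)
Lemma MI_le_log_card : (0 < #|TA|)%N -> (forall a, \sum_b P a b = #|TA|%:R^-1) ->
  MI P <= log2 #|TA|%:R.
Proof.
move=> TA0 PA.
have K0 : 0 < #|TA|%:R :> R by rewrite ltr0n.
have P1 : \sum_a \sum_b P a b = 1.
  by under eq_bigr do rewrite PA; rewrite sumr_const -[RHS](mulVf (x := #|TA|%:R)) ?gt_eqF // mulr_natr.
have -> : log2 #|TA|%:R = (\sum_a \sum_b P a b) * log2 #|TA|%:R by rewrite P1 mul1r.
rewrite mulr_suml; apply: ler_sum => a _.
rewrite mulr_suml; apply: ler_sum => b _.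
have [->|Pn] := eqVneq (P a b) 0; first by rewrite !mul0r.
have Pp : 0 < P a b by rewrite lt_def Pn P0.
have Qp : 0 < \sum_a' P a' b by apply: lt_le_trans Pp (joint_le_marg2 _ _).
rewrite ler_pM2l // PA; apply: ler_log2; first by rewrite divr_gt0 // mulr_gt0 // invr_gt0.
rewrite ler_pdivrMr ?mulr_gt0 ?invr_gt0 // mulVKf ?gt_eqF //.
exact: joint_le_marg2.
Qed.

End MutualInformation.

Lemma MI_eq (TA TB : finType) (P Q : TA -> TB -> R) :
  (forall a b, P a b = Q a b) -> MI P = MI Q.
Proof. by move=> PQ; congr MI; apply/funext => a; apply/funext => b. Qed.

Lemma MI_reindex (TA TB TB' : finType) (h : TB -> TB') (P : TA -> TB' -> R) :
  bijective h -> MI (fun a b => P a (h b)) = MI P.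
Proof.
move=> hb; apply: eq_bigr => a _; rewrite [RHS](reindex h) /=; last exact: onW_bij.
by apply: eq_bigr => b _; rewrite [in RHS](reindex h) //=; exact: onW_bij.
Qed.

(* If [l] is uniform and independent of the message [a], and [z1] depends on [l] only,
   then [I(a; z1 z2) <= I(a; l z1 z2) = I(a; z2 | l)]. *)
Lemma MI_mixture (L TA TZ1 TZ2 : finType) (v : L -> TZ1 -> R) (Q : L -> TA -> TZ2 -> R)
    (k : R) (P : TA -> TZ1 * TZ2 -> R) :
  (0 < #|L|)%N -> 0 < k ->
  (forall l z, 0 <= v l z) -> (forall l, \sum_z v l z = 1) ->
  (forall l a z, 0 <= Q l a z) -> (forall l a, \sum_z Q l a z = k) ->
  (forall a z, P a z = #|L|%:R^-1 * \sum_l v l z.1 * Q l a z.2) ->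
  MI P <= #|L|%:R^-1 * \sum_l MI (Q l).
Proof.
move=> L0 k0 v0 v1 Q0 Qk PE.
have L0' : 0 < #|L|%:R^-1 :> R by rewrite invr_gt0 ltr0n.
have PA a : \sum_z P a z = k.
  under eq_bigr => z _ do rewrite PE.
  rewrite -mulr_sumr exchange_big /=.
  under eq_bigr => l _.
    rewrite -(pair_bigA _ (fun z1 z2 => v l z1 * Q l a z2)) /=.
    under eq_bigr => z1 _ do rewrite -mulr_sumr Qk.
    rewrite -mulr_suml v1 mul1r; over.
  rewrite sumr_const -[k *+ _]mulr_natl mulrA mulVf ?mul1r //.
  by rewrite pnatr_eq0 -lt0n.
rewrite -(ler_pM2r ln2_gt0) -mulrA [in leRHS]mulr_suml.
under [in leRHS]eq_bigr => l _ do rewrite MI_ln2.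
rewrite MI_ln2 [in leRHS]exchange_big /= [in leRHS]mulr_sumr; apply: ler_sum => a _.
have -> : \sum_b P a b * ln (P a b / ((\sum_b' P a b') * \sum_a' P a' b)) =
    \sum_z1 \sum_z2 P a (z1, z2) * ln (P a (z1, z2) / (k * \sum_a' P a' (z1, z2))).
  by rewrite PA pair_bigA /=; apply: eq_bigr => -[z1 z2].
rewrite [in leLHS]exchange_big [in leRHS]exchange_big /= [in leRHS]mulr_sumr; apply: ler_sum => z2 _.
have -> : #|L|%:R^-1 * (\sum_l Q l a z2 *
     ln (Q l a z2 / ((\sum_b' Q l a b') * (\sum_a' Q l a' z2)))) =
   \sum_z1 \sum_l #|L|%:R^-1 * v l z1 * (Q l a z2 *
     ln (Q l a z2 / (k * (\sum_a' Q l a' z2)))).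
  rewrite exchange_big mulr_sumr; apply: eq_bigr => l _ /=.
  by rewrite -mulr_suml -mulr_sumr v1 mulr1 Qk.
apply: ler_sum => z1 _.
(* For fixed [a], [z1], [z2] the log-sum inequality is applied over [l]; the common factor
   [v l z1 / #|L|] cancels in [p l / q l]. *)
pose p l := #|L|%:R^-1 * (v l z1 * Q l a z2).
pose q l := #|L|%:R^-1 * (v l z1 * (k * \sum_a' Q l a' z2)).
have Pp : P a (z1, z2) = \sum_l p l by rewrite PE mulr_sumr.
have Qq : k * \sum_a' P a' (z1, z2) = \sum_l q l.
  under eq_bigr => a' _ do rewrite PE.
  rewrite -mulr_sumr /= exchange_big /= mulrCA mulr_sumr mulr_sumr.
  by apply: eq_bigr => l _; congr (_ * _); rewrite -mulr_sumr mulrCA.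
rewrite Qq Pp; apply: le_trans (log_sum _ _ _) _.
- by move=> l; rewrite mulr_ge0 ?mulr_ge0 // ltW.
- by move=> l; rewrite mulr_ge0 ?mulr_ge0 // ?sumr_ge0 // ltW.
- move=> l /eqP; rewrite !mulf_eq0 (gt_eqF L0') (gt_eqF k0) /= => /orP[/eqP v0l|/eqP Q0l].
    by rewrite /p v0l mul0r mulr0.
  suff -> : p l = 0 by [].
  have := joint_le_marg2 (Q0 l) a z2; rewrite Q0l => Qle.
  have /eqP Qz : Q l a z2 == 0 by rewrite eq_le Qle Q0.
  by rewrite /p Qz !mulr0.
apply: ler_sum => l _; have [vz|vn] := eqVneq (v l z1) 0.
  by rewrite /p vz !(mul0r, mulr0).
have -> : p l / q l = Q l a z2 / (k * \sum_a' Q l a' z2).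
  by rewrite /p /q -mulf_div divff ?gt_eqF // mul1r -mulf_div divff // mul1r.
by rewrite /p !mulrA.
Qed.

End Information.

(** * Product measures and sampling *)

Section ProductMeasure.
Variable R : realType.

(** Here [exp (x / 2) <= 1 / (1 - x / 2)], and [(1 + x) (1 - x / 2) >= 1] on the unit interval. *)
Lemma expR_half_le (x : R) : 0 <= x <= 1 -> expR (x / 2) <= 1 + x.
Proof.
move=> /andP[x0 x1].
have h : 0 < 1 - x / 2 by lra.
have := expR_ge1Dx (- (x / 2)); rewrite expRN => le1.
have : expR (x / 2) <= (1 - x / 2)^-1.
  by rewrite -[leLHS]invrK lef_pV2 ?posrE ?invr_gt0 ?expR_gt0.
by move/le_trans; apply; rewrite -[leLHS]mul1r ler_pdivrMr //; nra.
Qed.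

Section Sampling.
Variables (J G L : finType) (f : J -> G -> R) (mu : J -> R) (e : R).
Hypothesis G_gt0 : (0 < #|G|)%N.
Hypothesis L_gt0 : (0 < #|L|)%N.
Hypothesis f_bound : forall j g, 0 <= f j g <= 1.
Hypothesis f_mean : forall j, #|G|%:R^-1 * \sum_g f j g <= mu j.
Hypothesis L_large : #|J|%:R * expR (- (#|L|%:R * e / 2)) < 1.

Let mgf_le j : \sum_g expR (f j g / 2) <= #|G|%:R * expR (mu j).
Proof.
have G0 : 0 < #|G|%:R :> R by rewrite ltr0n.
apply: (@le_trans _ _ (\sum_g (1 + f j g))).
  by apply: ler_sum => g _; exact: expR_half_le.
rewrite big_split /= sumr_const -[leLHS](mulVKf (lt0r_neq0 G0)).
rewrite ler_pM2l // mulrDr mulVf ?gt_eqF //.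
by apply: le_trans (expR_ge1Dx _); rewrite lerD2l.
Qed.

(* Chernoff bound plus a union bound over [J]. *)
Lemma sampling : exists gam : {ffun L -> G},
  forall j, #|L|%:R^-1 * \sum_l f j (gam l) <= 2 * mu j + e.
Proof.
have G0 : 0 < #|G|%:R :> R by rewrite ltr0n.
have L0 : 0 < #|L|%:R :> R by rewrite ltr0n.
apply: contrapT => noex.
(* Exponential Markov inequality with parameter 1/2: a violated constraint alone contributes at
   least 1. Summed over all samples this contradicts [L_large]. *)
have bad (gam : {ffun L -> G}) : 1 <=
    \sum_j expR (\sum_l f j (gam l) / 2) * expR (- (#|L|%:R * (mu j + e / 2))).
  have [j jbad] : exists j, 2 * mu j + e < #|L|%:R^-1 * \sum_l f j (gam l).
    apply: contrapT => nj; apply: noex; exists gam => j.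
    by rewrite leNgt; apply/negP => jb; apply: nj; exists j.
  rewrite (bigD1 j) //= -[leLHS]addr0; apply: lerD; last first.
    by apply: sumr_ge0 => i _; rewrite mulr_ge0 // ltW // expR_gt0.
  rewrite -expRD -[leLHS]expR0 ler_expR subr_ge0 -mulr_suml.
  move: jbad; rewrite [ltRHS]mulrC ltr_pdivlMr // => /ltW.
  by set S := \sum_l _ => jb; lra.
have tot : \sum_(gam : {ffun L -> G}) (1 : R) <= \sum_(gam : {ffun L -> G})
    \sum_j expR (\sum_l f j (gam l) / 2) * expR (- (#|L|%:R * (mu j + e / 2))).
  by apply: ler_sum => gam _; exact: bad.
move: tot; apply/negP; rewrite -ltNge sumr_const card_ffun exchange_big /=.
apply: (@le_lt_trans _ _ (\sum_(j : J) (#|G| ^ #|L|)%:R * expR (- (#|L|%:R * e / 2)))).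
  apply: ler_sum => j _; rewrite -mulr_suml.
  have -> : \sum_(gam : {ffun L -> G}) expR (\sum_l f j (gam l) / 2) =
      (\sum_g expR (f j g / 2)) ^+ #|L|.
    under eq_bigr => gam _ do rewrite expR_sum.
    by rewrite -(bigA_distr_bigA (fun _ g => expR (f j g / 2))) prodr_const.
  apply: (@le_trans _ _ ((#|G|%:R * expR (mu j)) ^+ #|L| *
                         expR (- (#|L|%:R * (mu j + e / 2))))).
    rewrite ler_pM2r ?expR_gt0 // lerXn2r ?nnegrE ?sumr_ge0 ?mgf_le //.
  rewrite exprMn -natrX -[leLHS]mulrA; apply: ler_wpM2l => //.
  by rewrite -expRM_natl -expRD ler_expR; lra.
rewrite sumr_const -[ltLHS]mulr_natl mulrCA -[ltRHS]mulr1 ltr_pM2l //.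
by rewrite natrX exprn_gt0.
Qed.

End Sampling.

Section Chebyshev.
Variables (I Y : finType) (w g : I -> Y -> R).
Hypothesis w_ge0 : forall i y, 0 <= w i y.
Hypothesis w_sum1 : forall i, \sum_y w i y = 1.
Hypothesis g_le1 : forall i y, `|g i y| <= 1.
Hypothesis g_mean0 : forall i, \sum_y w i y * g i y = 0.

Lemma sum_prod_channel : \sum_(y : {ffun I -> Y}) \prod_i w i (y i) = 1.
Proof. by rewrite -bigA_distr_bigA big1 // => i _; exact: w_sum1. Qed.

Let cross i j : i != j ->
  \sum_(y : {ffun I -> Y}) (\prod_u w u (y u)) * (g i (y i) * g j (y j)) = 0.
Proof.
move=> ij.
pose F u z := w u z * ((if u == i then g u z else 1) * (if u == j then g u z else 1)).
rewrite (eq_bigr (fun y : {ffun I -> Y} => \prod_u F u (y u))); last first.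
  move=> y _; rewrite 2!big_split /=; congr (_ * (_ * _)).
    by rewrite -big_mkcond big_pred1_eq.
  by rewrite -big_mkcond big_pred1_eq.
rewrite -bigA_distr_bigA (bigD1 i) //= /F.
under eq_bigr do rewrite eqxx (negbTE ij) mulr1.
by rewrite g_mean0 mul0r.
Qed.

Let second_moment :
  \sum_(y : {ffun I -> Y}) (\prod_i w i (y i)) * (\sum_i g i (y i)) ^+ 2 <= #|I|%:R.
Proof.
have -> : \sum_(y : {ffun I -> Y}) (\prod_i w i (y i)) * (\sum_i g i (y i)) ^+ 2 =
  \sum_i \sum_j \sum_(y : {ffun I -> Y}) (\prod_u w u (y u)) * (g i (y i) * g j (y j)).
  under [RHS]eq_bigr do rewrite exchange_big /=.
  rewrite [RHS]exchange_big /=; apply: eq_bigr => y _.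
  rewrite expr2 mulr_suml mulr_sumr; apply: eq_bigr => i _.
  by rewrite mulr_sumr mulr_sumr.
apply: (@le_trans _ _ (\sum_(i : I) 1)); last by rewrite sumr_const.
apply: ler_sum => i _; rewrite (bigD1 i) //= [X in _ + X]big1 ?addr0; last first.
  by move=> j ji; apply: cross; rewrite eq_sym.
rewrite -[leRHS]sum_prod_channel; apply: ler_sum => y _.
rewrite -[leRHS]mulr1 ler_wpM2l ?prodr_ge0 // -expr2 -real_normK ?num_real //.
by rewrite expr_le1.
Qed.

(** The coordinates are independent and the [g i] are centred and bounded by 1, so the second moment
    of the sum is at most [#|I|]. *)
Lemma chebyshev (e : R) : 0 < e ->
  \sum_(y : {ffun I -> Y} | e < `|\sum_i g i (y i)|) \prod_i w i (y i)
    <= #|I|%:R / e ^+ 2.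
Proof.
move=> e0; rewrite ler_pdivlMr ?exprn_gt0 //; apply: le_trans second_moment.
rewrite big_mkcond mulr_suml; apply: ler_sum => y _; case: ifPn => [big|_].
  rewrite ler_wpM2l ?prodr_ge0 // -[leRHS]real_normK ?num_real //.
  by rewrite lerXn2r ?nnegrE // ltW.
by rewrite mul0r mulr_ge0 ?prodr_ge0 ?sqr_ge0.
Qed.

End Chebyshev.

(* The involution exchanging [a] and [t i] in the pair [(t, a)] shows that the
   coordinate [t i] is uniform and independent of the other ones. *)
Lemma sum_ffun_coord (I X : finType) (i : I) (F : X -> R) (H : {ffun I -> X} -> R) :
  (0 < #|X|)%N -> \sum_a F a = 0 ->
  (forall t t' : {ffun I -> X}, (forall k, k != i -> t k = t' k) -> H t = H t') ->
  \sum_(t : {ffun I -> X}) F (t i) * H t = 0.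
Proof.
move=> X0 F0 Hi.
pose upd (t : {ffun I -> X}) a : {ffun I -> X} := [ffun k => if k == i then a else t k].
have Hupd t a : H (upd t a) = H t.
  by apply: Hi => k /negbTE ki; rewrite ffunE ki.
pose h (p : {ffun I -> X} * X) := (upd p.1 p.2, p.1 i).
have hK : involutive h.
  case=> t a; rewrite /h /= /upd ffunE eqxx; congr (_, _).
  by apply/ffunP => k; rewrite !ffunE; case: eqP => // ->.
have : \sum_(p : {ffun I -> X} * X) F p.2 * H p.1 =
    #|X|%:R * \sum_(t : {ffun I -> X}) F (t i) * H t.
  rewrite (reindex h) /=; last by apply: onW_bij; exact: (Bijective hK hK).
  rewrite (eq_bigr (fun p : {ffun I -> X} * X => F (p.1 i) * H p.1)); last first.
    by move=> p _; rewrite /h /= Hupd.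
  rewrite -(pair_bigA _ (fun (t : {ffun I -> X}) (_ : X) => F (t i) * H t)) /= mulr_sumr.
  by apply: eq_bigr => t _; rewrite sumr_const mulr_natl.
rewrite -(pair_bigA _ (fun (t : {ffun I -> X}) a => F a * H t)) /=.
under eq_bigr do rewrite -mulr_suml F0 mul0r.
rewrite big1 // => /esym/eqP; rewrite mulf_eq0 pnatr_eq0 -leqn0 leqNgt X0 /=.
by move/eqP.
Qed.

Lemma sum_ffun_coord_mean (I X : finType) (i : I) (F : X -> R) (H : {ffun I -> X} -> R) :
  (0 < #|X|)%N ->
  (forall t t' : {ffun I -> X}, (forall k, k != i -> t k = t' k) -> H t = H t') ->
  \sum_(t : {ffun I -> X}) F (t i) * H t = (\sum_a F a) / #|X|%:R * \sum_t H t.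
Proof.
move=> X0 Hi; set mean := _ / _.
have mean0 : \sum_a (F a - mean) = 0.
  rewrite sumrB sumr_const -[mean *+ _]mulr_natr divfK ?subrr //.
  by rewrite pnatr_eq0 -lt0n.
have := sum_ffun_coord X0 mean0 Hi.
rewrite (eq_bigr (fun t : {ffun I -> X} => F (t i) * H t - mean * H t)); last first.
  by move=> t _; rewrite mulrBl.
by rewrite sumrB -mulr_sumr => /eqP; rewrite subr_eq0 => /eqP.
Qed.

(** Expand the nonnegative squared distance from [u] to the combination of the [w j] with
    coefficients [c j / m]; orthogonality removes the cross terms. Only the bound [m] on the squared
    norms of the [w j] is used in place of normalization. *)
Lemma bessel (I J : finType) (F : {set J}) (w : J -> I -> R) (u : I -> R) (d : R) :
  (0 < #|I|)%N -> 0 <= d -> (forall j i, `|w j i| <= 1) -> (forall i, `|u i| <= 1) ->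
  {in F &, forall j k, j != k -> \sum_i w j i * w k i = 0} ->
  {in F, forall j, d * #|I|%:R <= `|\sum_i w j i * u i|} ->
  #|F|%:R * d ^+ 2 <= 1.
Proof.
move=> I0 d0 w1 u1 orth large; set m : R := #|I|%:R.
have m0 : 0 < m by rewrite ltr0n.
pose c j := \sum_i w j i * u i; pose C := \sum_(j in F) c j ^+ 2.
have sq_le1 x : `|x| <= 1 -> x ^+ 2 <= 1 :> R.
  by move=> x1; rewrite -real_normK ?num_real // expr_le1.
have CF : #|F|%:R * (d ^+ 2 * m ^+ 2) <= C.
  rewrite mulr_natl -sumr_const; apply: ler_sum => j jF.
  rewrite -exprMn -[leRHS]real_normK ?num_real // lerXn2r ?nnegrE ?large //.
  by rewrite mulr_ge0 // ltW.
have Cm : C <= m ^+ 2.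
  have : 0 <= \sum_i (u i - m^-1 * \sum_(j in F) c j * w j i) ^+ 2.
    by apply: sumr_ge0 => i _; exact: sqr_ge0.
  have -> : \sum_i (u i - m^-1 * \sum_(j in F) c j * w j i) ^+ 2 =
      \sum_i u i ^+ 2 - 2 * m^-1 * C
      + m^-1 ^+ 2 * \sum_(j in F) c j ^+ 2 * \sum_i w j i ^+ 2.
    rewrite (eq_bigr (fun i => u i ^+ 2 - 2 * m^-1 * (u i * \sum_(j in F) c j * w j i)
       + m^-1 ^+ 2 * (\sum_(j in F) c j * w j i) ^+ 2)); last by move=> i _; ring.
    rewrite big_split sumrB /= -!mulr_sumr; congr (_ - _ * _ + _ * _).
      under eq_bigr do rewrite mulr_sumr.
      rewrite exchange_big /=; apply: eq_bigr => j _.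
      by rewrite expr2 [X in X * _]/c mulr_suml; apply: eq_bigr => i _; ring.
    under [LHS]eq_bigr do rewrite expr2 mulr_suml.
    rewrite exchange_big /=; apply: eq_bigr => j jF.
    under eq_bigr do rewrite mulr_sumr.
    rewrite exchange_big (bigD1 j) //= [X in _ + X]big1 ?addr0.
      by rewrite mulr_sumr; apply: eq_bigr => i _; ring.
    move=> k /andP[kF kj].
    rewrite (eq_bigr (fun i => c j * c k * (w j i * w k i))); last by move=> i _; ring.
    by rewrite -mulr_sumr orth ?mulr0 // eq_sym.
  have U : \sum_i u i ^+ 2 <= m.
    apply: le_trans (ler_sum _ (fun i _ => sq_le1 _ (u1 i))) _.
    by rewrite sumr_const.
  have V : \sum_(j in F) c j ^+ 2 * \sum_i w j i ^+ 2 <= C * m.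
    rewrite mulr_suml; apply: ler_sum => j jF; rewrite ler_wpM2l ?sqr_ge0 //.
    apply: le_trans (ler_sum _ (fun i _ => sq_le1 _ (w1 j i))) _.
    by rewrite sumr_const.
  move=> pos; have {}pos : 0 <= m - 2 * m^-1 * C + m^-1 ^+ 2 * (C * m).
    apply: le_trans pos _; apply: lerD; first by rewrite lerD2r.
    by rewrite ler_wpM2l // exprn_ge0 // invr_ge0 ltW.
  have mC : m^-1 ^+ 2 * (C * m) = m^-1 * C by field; rewrite gt_eqF.
  rewrite mC in pos; have {}pos : m^-1 * C <= m by lra.
  by rewrite expr2 -ler_pdivrMl.
have := le_trans CF Cm; rewrite mulrA -[leRHS]mul1r ler_pM2r //.
by rewrite exprn_gt0.
Qed.

End ProductMeasure.

(** * Public transmission over a nonsymmetrizable channel *)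

Section SymmetrizabilityGap.
Variables (R : realType) (A : AVWC R).
Notation X := (avX A).
Notation S := (avS A).
Notation Y := (avY A).
(** Matrices of transition probabilities as points of a product space, so that Tychonoff's theorem
    gives compactness of the channels. *)
Notation PT := (prod_topology (fun _ : X * S => R : topologicalType)).

Let eval_continuous (p : X * S) : continuous (fun f : PT => f p).
Proof. exact: proj_continuous. Qed.

Let channels : set PT := [set f | is_channel (fun x s => f (x, s))]%classic.

Let compact_channels : compact channels.
Proof.
apply: (@subclosed_compact _ _ [set f : PT | forall i, `[(0:R), 1]%classic (f i)]).
- have -> : channels =
      ((\bigcap_(p in [set: X * S]) [set f : PT | 0 <= f p]) `&`
      (\bigcap_(x in [set: X]) [set f : PT | (\sum_s f (x, s))%R = 1]))%classic.
    apply/seteqP; split=> [f [f0 f1]|f [f0 f1]].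
      by split=> [[x s] _|x _]; [exact: f0|exact: f1].
    by split=> [x s|x]; [exact: f0|exact: f1].
  apply: closedI; apply: closed_bigI => p _.
    apply: (@closed_comp _ _ (fun f : PT => f p) [set r | 0 <= r]%classic).
      by move=> f _; exact: eval_continuous.
    exact: closed_ge.
  apply: (@closed_comp _ _ (fun f : PT => \sum_s f (p, s)) [set r | r = 1]%classic).
    move=> f _; apply: continuous_big; first exact: add_continuous.
    by move=> s _; exact: eval_continuous.
  exact: closed_eq.
- apply: (@tychonoff _ (fun _ : X * S => R : topologicalType) (fun _ => `[(0:R), 1]%classic)).
  by move=> i; exact: segment_compact.
- move=> f [f0 f1] [x s] /=; rewrite in_itv /= f0 /= -(f1 x) (bigD1 s) //=.
  by rewrite lerDl sumr_ge0.
Qed.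

Let defect (U : PT) (p : X * X * Y) : R :=
  `|\sum_s U (p.1.2, s) * avW s p.1.1 p.2 - \sum_s U (p.1.1, s) * avW s p.1.2 p.2|.

Let defect_continuous : continuous (fun U : PT => \sum_p defect U p).
Proof.
have sumc x (h : S -> R) : continuous (fun U : PT => \sum_s U (x, s) * h s).
  apply: continuous_big; first exact: add_continuous.
  move=> s _ U.
  apply: (@cvgM R _ (nbhs U) _ (fun V : PT => V (x, s)) (fun=> h s) (U (x, s)) (h s)).
    exact: (@eval_continuous (x, s) U).
  exact: cvg_cst.
apply: continuous_big; first exact: add_continuous.
move=> p _ U.
have c1 := sumc p.1.2 (fun s => avW s p.1.1 p.2) U.
have c2 := sumc p.1.1 (fun s => avW s p.1.2 p.2) U.
exact: (cvg_norm (cvgB c1 c2)).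
Qed.

(* By compactness of the set of channels, nonsymmetrizability holds with a margin. *)
Lemma symmetrizability_gap : ~ symmetrizable A ->
  exists2 d : R, 0 < d & forall U U' : X -> S -> R, is_channel U -> is_channel U' ->
    ~ forall a b y,
      `|\sum_s U b s * avW s a y - \sum_s U' a s * avW s b y| <= d.
Proof.
move=> nsym.
have ne : (channels !=set0)%classic.
  exists (fun p : X * S => (p.2 == avS_inh A)%:R); split=> [x s|x] /=.
    by case: (_ == _); rewrite ?ler01.
  rewrite (bigD1 (avS_inh A)) //= eqxx big1 ?addr0 // => s /negbTE -> //.
have [U0 /set_mem [U00 U01] minU0] := compact_EVT_min ne compact_channels
  (continuous_subspaceT defect_continuous).
have d0 : 0 < \sum_p defect U0 p.
  rewrite lt_def sumr_ge0 ?andbT; last by move=> p _; exact: normr_ge0.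
  apply/eqP => dz; apply: nsym; exists (fun x s => U0 (x, s)); split=> // x x' y.
  move/eqP: dz; rewrite psumr_eq0; last by move=> p _; exact: normr_ge0.
  move/allP/(_ (x', x, y) (mem_index_enum _)).
  by rewrite normr_eq0 subr_eq0 => /eqP.
(* One more than the number of terms, so that defects bounded by [total / N] sum to strictly less
   than the minimal total. *)
pose N : R := (#|{: X * X * Y}|.+1)%:R.
have N0 : 0 < N by rewrite ltr0n.
exists ((\sum_p defect U0 p) / N); first by rewrite divr_gt0.
move=> U U' [U_0 U_1] [U'_0 U'_1] close.
(* Averaging [U] and [U'] and using the closeness at both [(a, b)] and [(b, a)] turns an approximate
   two-channel identity into an approximate symmetrization by one channel. *)
pose V : PT := fun p => (U p.1 p.2 + U' p.1 p.2) / 2.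
have chV : V \in channels.
  apply/mem_set; split=> [x s|x].
    by rewrite /V divr_ge0 // addr_ge0.
  by rewrite /V -mulr_suml big_split /= U_1 U'_1; lra.
have defV p : defect V p <= (\sum_p defect U0 p) / N.
  case: p => -[a b] y; move: (_ / N) close => d close; rewrite /defect /=.
  have VE c (h : S -> R) : \sum_s V (c, s) * h s =
      (\sum_s U c s * h s + \sum_s U' c s * h s) / 2.
    by rewrite -big_split mulr_suml; apply: eq_bigr => s _; rewrite /V /=; lra.
  rewrite !VE; have := close a b y; have := close b a y.
  move: (\sum_s U b s * avW s a y) (\sum_s U' b s * avW s a y)
    (\sum_s U a s * avW s b y) (\sum_s U' a s * avW s b y) => u1 u2 u3 u4.
  by rewrite !ler_norml => /andP[? ?] /andP[? ?]; apply/andP; split; lra.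
have := minU0 _ chV; apply/negP; rewrite -ltNge.
apply: le_lt_trans (ler_sum _ (fun p _ => defV p)) _.
rewrite sumr_const -mulr_natr -mulrA gtr_pMr // mulrC ltr_pdivrMr // mul1r.
by rewrite ltr_nat.
Qed.

End SymmetrizabilityGap.

Section PrefixCodes.
Variable R : realType.

(** Deterministic codewords with average error at most [e] against every state sequence. The message
    set is any finite type of size [L], so concatenation can take a product type. *)
Definition prefix_code (A : AVWC R) (m L : nat) (e : R) : Prop :=
  exists (M : finType) (x : M -> {ffun 'I_m -> avX A}) (D : M -> {set {ffun 'I_m -> avY A}}),
    [/\ #|M| = L, (forall l l', l != l' -> [disjoint D l & D l']) &
        forall s, 1 - e <= L%:R^-1 * \sum_l \sum_(y in D l) nW s (x l) y].

Lemma nW_channel (A : AVWC R) n (s : {ffun 'I_n -> avS A}) : is_channel (nW s).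
Proof.
split=> [x y|x]; first by apply: prodr_ge0 => i _; case: (avW_ch (s i)).
by apply: (sum_prod_channel (w := fun i => avW (s i) (x i))) => i; case: (avW_ch (s i)).
Qed.

Lemma nV_channel (A : AVWC R) n (s : {ffun 'I_n -> avS A}) : is_channel (nV s).
Proof.
split=> [x y|x]; first by apply: prodr_ge0 => i _; case: (avV_ch (s i)).
by apply: (sum_prod_channel (w := fun i => avV (s i) (x i))) => i; case: (avV_ch (s i)).
Qed.

Lemma sum_ind_eq (T : finType) (F : T -> R) (a : T) : \sum_t (t == a)%:R * F t = F a.
Proof.
rewrite (bigD1 a) //= eqxx mul1r big1 ?addr0 // => t /negbTE ->.
by rewrite mul0r.
Qed.

Lemma channel_le1 (T1 T2 : finType) (W : T1 -> T2 -> R) : is_channel W ->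
  forall a b, W a b <= 1.
Proof. by move=> [W0 W1] a b; rewrite -(W1 a) (bigD1 b) //= lerDl sumr_ge0. Qed.

Lemma sum_set_le1 (T : finType) (p : T -> R) (D : {set T}) :
  (forall t, 0 <= p t) -> \sum_t p t = 1 -> \sum_(t in D) p t <= 1.
Proof.
move=> p0 <-; rewrite [leRHS](bigID (mem D)) /= lerDl.
exact: sumr_ge0.
Qed.

Lemma boolr_ge0 (b : bool) : 0 <= b%:R :> R.
Proof. by rewrite ler0n. Qed.

Lemma boolr_norm_le1 (b : bool) : `|b%:R : R| <= 1.
Proof. by case: b; rewrite ?normr1 ?normr0. Qed.

End PrefixCodes.

(** * Block codes with independent-looking codewords, and their decoding *)

Section Block.
Variables (R : realType) (A : AVWC R) (K : nat).
Notation X := (avX A).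
Notation S := (avS A).
Notation Y := (avY A).
Notation T := {ffun 'I_K -> X}.
Notation m := #|{: T}|.

Hypothesis K_gt0 : (0 < K)%N.

Let q : R := #|X|%:R.
Let mR : R := m%:R.

Let q_gt0 : 0 < q.
Proof. by rewrite ltr0n; apply/card_gt0P; exists (avX_inh A). Qed.

Let m_gt0 : 0 < mR.
Proof. by rewrite ltr0n; apply/card_gt0P; exists [ffun=> avX_inh A]. Qed.

(* The [t]-th letters of all the codewords run over [X ^ K] as [t] varies: the
   codewords behave exactly like independent uniform random words. *)
Definition cw (i : 'I_K) : {ffun 'I_m -> X} := [ffun t => (enum_val t : T) i].

Let sum_enum (F : T -> R) : \sum_(t < m) F (enum_val t) = \sum_t F t.
Proof.
by rewrite [RHS](reindex _ (onW_bij _ (enum_val_bij T))).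
Qed.

Let cw_indep (i j k l : 'I_K) (F : X -> R) (G : X -> X -> X -> R) :
  \sum_a F a = 0 -> j != i -> k != i -> l != i ->
  \sum_t F (cw i t) * G (cw j t) (cw k t) (cw l t) = 0.
Proof.
move=> F0 ji ki li.
rewrite (eq_bigr (fun t : 'I_m => F ((enum_val t : T) i) *
   G ((enum_val t : T) j) ((enum_val t : T) k) ((enum_val t : T) l))); last first.
  by move=> t _; rewrite !ffunE.
rewrite (sum_enum (fun t => F (t i) * G (t j) (t k) (t l))).
apply: (sum_ffun_coord (H := fun t : T => G (t j) (t k) (t l))) => // [|t t' tt'].
  by rewrite -(ltr0n R).
by rewrite !tt'.
Qed.

(** The indicator of [a], centred under the uniform law on letters. *)
Let phi (a x : X) : R := (x == a)%:R - q^-1.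

Let phi_sum0 a : \sum_x phi a x = 0.
Proof.
rewrite sumrB sumr_const -[X in _ - X]mulr_natr mulVf ?gt_eqF //.
by rewrite (eq_bigr (fun x => (x == a)%:R * 1)) ?sum_ind_eq ?subrr // => x; rewrite mulr1.
Qed.

Let phi_le1 a x : `|phi a x| <= 1.
Proof.
have q1 : q^-1 <= 1 by rewrite invf_le1 // ler1n -(ltr0n R).
have q0 : 0 <= q^-1 by rewrite invr_ge0 ltW.
by rewrite /phi ler_norml; case: (x == a); rewrite ?mulr1n ?mulr0n; apply/andP; split; lra.
Qed.

Let cw_freq j b : \sum_t (cw j t == b)%:R = mR / q.
Proof.
have : \sum_t phi b (cw j t) = 0.
  rewrite (eq_bigr (fun t : 'I_m => phi b ((enum_val t : T) j) * 1)); last first.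
    by move=> t _; rewrite ffunE mulr1.
  rewrite (sum_enum (fun t => phi b (t j) * 1)).
  by apply: (sum_ffun_coord (H := fun=> 1)) => //; rewrite -(ltr0n R).
rewrite sumrB sumr_const card_ord -mulr_natl => /eqP.
by rewrite subr_eq0 => /eqP.
Qed.

Section Attack.
Variable s : {ffun 'I_m -> S}.
Variable d : R.
Hypothesis d_gt0 : 0 < d.

Let w a b (i j : 'I_K) (t : 'I_m) : R := phi a (cw i t) * (cw j t == b)%:R.

(** Measures how far state [sg], at the times when word [j] shows [b], favours or avoids those when
    word [i] shows [a]. A large value means that the adversary targets [i]. *)
Let corr a b sg i j : R := \sum_t w a b i j t * (s t == sg)%:R.

Let w_orth a b i j k l : j != i -> k != i -> l != i ->
  \sum_t w a b i j t * w a b k l t = 0.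
Proof.
move=> ji ki li.
rewrite -[RHS](cw_indep (fun x y z => (x == b)%:R * (phi a y * (z == b)%:R))
  (phi_sum0 a) ji ki li).
by apply: eq_bigr => t _; rewrite /w; ring.
Qed.

Let badset (r : rel 'I_K) a b sg : {set 'I_K} :=
  [set i | [exists j, r j i && (d * mR < `|corr a b sg i j|)]].

(** Each bad [i] selects a competitor [J i]; the default value occurs only off the bad set. For
    distinct bad [i] and [k], asymmetry of [r] excludes having both [J k = i] and [J i = k], so one
    of the two centred letters is independent of the rest of the product. The test functions are
    thus orthogonal and Bessel's inequality bounds their number. *)
Let card_badset (r : rel 'I_K) a b sg : (forall i j, r i j -> ~~ r j i) ->
  #|badset r a b sg|%:R * d ^+ 2 <= 1.
Proof.
move=> rasym.
pose J i := odflt i [pick j | r j i && (d * mR < `|corr a b sg i j|)].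
have JP i : i \in badset r a b sg -> r (J i) i && (d * mR < `|corr a b sg i (J i)|).
  rewrite inE => /existsP[j jP]; rewrite /J; case: pickP => [//|/(_ j)].
  by rewrite jP.
have rneq i j : r i j -> i != j.
  by move=> rij; apply/eqP => eij; move: (rasym _ _ rij); rewrite -eij in rij *; rewrite rij.
apply: (@bessel R _ _ _ (fun i => w a b i (J i)) (fun t => (s t == sg)%:R)).
- by rewrite card_ord -(ltr0n R).
- exact: ltW.
- move=> i t; rewrite normrM; apply: mulr_ile1 => //; last exact: boolr_norm_le1.
- by move=> t; exact: boolr_norm_le1.
- move=> i k /JP/andP[ri _] /JP/andP[rk _] ik.
  have [e|ne] := eqVneq (J k) i; last first.
    by apply: w_orth => //; [exact: rneq|rewrite eq_sym].
  rewrite (eq_bigr (fun t => w a b k (J k) t * w a b i (J i) t)); last first.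
    by move=> t _; rewrite mulrC.
  apply: w_orth => //; first exact: rneq.
  apply/eqP => e'; move: (rasym _ _ rk); rewrite e -[in X in r k X]e.
  by rewrite e in rk *; rewrite -e' ri.
- by move=> i /JP/andP[_ /ltW]; rewrite card_ord.
Qed.

Let bad (i : 'I_K) : bool :=
  [exists j, (j != i) && [exists a, exists b, exists sg, d * mR < `|corr a b sg i j|]].

(** Each bad message lies in a bad set for one of 2 orderings of the competitor, [q ^ 2] letter
    pairs and [#|S|] states, and each such set has at most [1 / d ^ 2] elements. *)
Let card_bad : \sum_i (bad i)%:R <= 2 * q ^+ 2 * #|S|%:R / d ^+ 2.
Proof.
pose rr (c : bool) : rel 'I_K := fun i j => if c then (i < j)%N else (j < i)%N.
have bad_in i : bad i -> exists p : bool * X * X * S, i \in badset (rr p.1.1.1) p.1.1.2 p.1.2 p.2.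
  move=> /existsP[j /andP[ji /existsP[a /existsP[b /existsP[sg big]]]]].
  exists (((j < i)%N, a), b, sg); rewrite inE /=; apply/existsP; exists j.
  rewrite big andbT /rr; case: ltngtP => // /val_inj e.
  by rewrite e eqxx in ji.
apply: (@le_trans _ _ (\sum_(p : bool * X * X * S)
    \sum_(i in badset (rr p.1.1.1) p.1.1.2 p.1.2 p.2) (1 : R))).
  rewrite (exchange_big_dep xpredT) //=; apply: ler_sum => i _; case: (boolP (bad i)) => [bi|_].
    have [p pin] := bad_in _ bi; rewrite (bigD1 p) //= lerDl.
    by apply: sumr_ge0.
  by apply: sumr_ge0.
apply: (@le_trans _ _ (\sum_(p : bool * X * X * S) d ^- 2)).
  apply: ler_sum => p _; rewrite sumr_const -[leRHS]mul1r ler_pdivlMr ?exprn_gt0 //.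
  apply: card_badset => i j; rewrite /rr; case: p.1.1.1; rewrite -leqNgt; exact: ltnW.
rewrite sumr_const !card_prod card_bool -[leLHS]mulr_natl ler_pM2r ?invr_gt0 ?exprn_gt0 //.
by rewrite !natrM expr2 !mulrA.
Qed.

Variable dl : R.
Hypothesis dl_gt0 : 0 < dl.
Hypothesis d_dl : q ^+ 2 * #|S|%:R * d = dl / 4.

(* [i] is accepted if, against every competitor [j], the output looks as if [i] had
   been sent while the adversary drew states from a channel fed with [x_j]. *)
Definition accept (i : 'I_K) (y : {ffun 'I_m -> Y}) : Prop :=
  forall j, j != i -> exists U : X -> S -> R, is_channel U /\ forall a b eta,
    `|q ^+ 2 / mR * (\sum_t (cw i t == a)%:R * (cw j t == b)%:R * (y t == eta)%:R)
      - \sum_sg U b sg * avW sg a eta| <= dl / 2.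

Let dev (i j : 'I_K) a b eta (t : 'I_m) (z : Y) : R :=
  (cw i t == a)%:R * (cw j t == b)%:R * ((z == eta)%:R - avW (s t) (cw i t) eta).

(** The fluctuation threshold that becomes [dl / 4] after scaling by [q ^ 2 / mR]; by [d_dl] the
    correlations cost another [dl / 4], which fills the tolerance of [accept]. *)
Let e : R := mR * dl / (4 * q ^+ 2).

(** The joint statistics split into a fluctuation around the conditional mean, a correlation term,
    small since [i] is not bad, and the [U]-average required by acceptance. *)
Let accept_good i (y : {ffun 'I_m -> Y}) : ~~ bad i ->
  (forall j a b eta, `|\sum_t dev i j a b eta t (y t)| <= e) -> accept i y.
Proof.
move=> good small j ji.
have q0 := gt_eqF q_gt0; have m0 := gt_eqF m_gt0.
(* The empirical law of the state over the times when word [j] shows [b]; every letter has exact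
   frequency [mR / q] in each codeword, so this is a channel. *)
pose U b sg := q / mR * \sum_t (cw j t == b)%:R * (s t == sg)%:R.
exists U; split.
  split=> [b sg|b].
    apply: mulr_ge0; first by rewrite divr_ge0 // ltW.
    by apply: sumr_ge0 => t _; rewrite mulr_ge0 // boolr_ge0.
  rewrite /U -mulr_sumr exchange_big /= (eq_bigr (fun t => (cw j t == b)%:R)).
    by rewrite cw_freq; field; rewrite q0 m0.
  move=> t _; rewrite -mulr_sumr -[RHS]mulr1; congr (_ * _).
  rewrite -[RHS](sum_ind_eq (fun=> 1) (s t)).
  by apply: eq_bigr => sg _; rewrite mulr1 eq_sym.
move=> a b eta.
have -> : \sum_t (cw i t == a)%:R * (cw j t == b)%:R * (y t == eta)%:R =
  \sum_t dev i j a b eta t (y t) +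
  \sum_sg (corr a b sg i j + mR / q ^+ 2 * U b sg) * avW sg a eta.
  have -> : \sum_sg (corr a b sg i j + mR / q ^+ 2 * U b sg) * avW sg a eta =
     \sum_t (cw i t == a)%:R * (cw j t == b)%:R * avW (s t) (cw i t) eta.
    rewrite (eq_bigr (fun sg => \sum_t (cw i t == a)%:R * (cw j t == b)%:R *
        ((s t == sg)%:R * avW sg a eta))); last first.
      move=> sg _; rewrite /U /corr mulrA mulr_sumr -big_split /= mulr_suml.
      apply: eq_bigr => t _; rewrite /w /phi.
      by field; rewrite q0 m0.
    rewrite exchange_big /=; apply: eq_bigr => t _; rewrite -mulr_sumr.
    rewrite (eq_bigr (fun sg => (sg == s t)%:R * avW sg a eta)); last first.
      by move=> sg _; rewrite eq_sym.
    by rewrite sum_ind_eq; case: eqP => [->//|_]; rewrite !mul0r.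
  by rewrite -big_split /=; apply: eq_bigr => t _; rewrite /dev; ring.
rewrite mulrDr -addrA.
have -> : q ^+ 2 / mR * (\sum_sg (corr a b sg i j + mR / q ^+ 2 * U b sg) * avW sg a eta)
    - \sum_sg U b sg * avW sg a eta = q ^+ 2 / mR * \sum_sg corr a b sg i j * avW sg a eta.
  rewrite !mulr_sumr -sumrB; apply: eq_bigr => sg _.
  by field; rewrite q0 m0.
rewrite -mulrDr normrM ger0_norm; last by rewrite divr_ge0 ?exprn_ge0 ?ltW.
apply: (@le_trans _ _ (q ^+ 2 / mR * (e + #|S|%:R * (d * mR)))).
  rewrite ler_pM2l ?divr_gt0 ?exprn_gt0 //; apply: le_trans (ler_normD _ _) _.
  apply: lerD; first exact: small.
  apply: le_trans (ler_norm_sum _ _ _) _.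
  rewrite mulr_natl -sumr_const; apply: ler_sum => sg _; rewrite normrM.
  rewrite -[leRHS]mulr1; apply: ler_pM => //.
    rewrite leNgt; apply/negP => big; move/negP: good; apply.
    apply/existsP; exists j; rewrite ji /=; apply/existsP; exists a.
    by apply/existsP; exists b; apply/existsP; exists sg.
  rewrite ger0_norm; first exact: channel_le1 (avW_ch sg) _ _.
  by case: (avW_ch sg).
have -> : q ^+ 2 / mR * (e + #|S|%:R * (d * mR)) = dl / 4 + q ^+ 2 * #|S|%:R * d.
  by rewrite /e; field; rewrite q0 m0.
by rewrite d_dl; lra.
Qed.

Let decode_set i : {set {ffun 'I_m -> Y}} := [set y | `[< accept i y >]].

(** Rejection of a message that is not bad forces some deviation beyond [e]; Chebyshev's inequality
    and a union bound over competitor, letters and output symbol estimate this event. *)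
Let success_good i : ~~ bad i ->
  1 - K%:R * q ^+ 2 * #|Y|%:R * (mR / e ^+ 2) <= \sum_(y in decode_set i) nW s (cw i) y.
Proof.
move=> good; have [nW0 nW1] := nW_channel s.
rewrite lerBlDr -lerBlDl -[X in X - _ <= _](nW1 (cw i)).
rewrite (bigID (mem (decode_set i))) /= addrC addrK.
pose B (p : 'I_K * X * X * Y) (y : {ffun 'I_m -> Y}) :=
  e < `|\sum_t dev i p.1.1.1 p.1.1.2 p.1.2 p.2 t (y t)|.
apply: (@le_trans _ _ (\sum_p \sum_(y | B p y) nW s (cw i) y)).
  rewrite (exchange_big_dep xpredT) //= big_mkcond; apply: ler_sum => y _.
  case: ifPn => [yn|_]; last by apply: sumr_ge0.
  have [[[[j a] b] eta] bp] : exists p, B p y.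
    apply: contrapT => nB; move/negP: yn; apply; rewrite inE; apply/asboolP.
    apply: accept_good => // j a b eta; rewrite leNgt; apply/negP => big.
    by apply: nB; exists (j, a, b, eta).
  by rewrite (bigD1 (j, a, b, eta)) //= lerDl sumr_ge0.
apply: (@le_trans _ _ (\sum_(p : 'I_K * X * X * Y) mR / e ^+ 2)).
  apply: ler_sum => -[[[j a] b] eta] _.
  have -> : mR = #|{: 'I_m}|%:R by rewrite card_ord.
  apply: (@chebyshev R _ _ (fun t => avW (s t) (cw i t)) (dev i j a b eta)).
  - by move=> t z; case: (avW_ch (s t)).
  - by move=> t; case: (avW_ch (s t)).
  - move=> t z; rewrite /dev !normrM; apply: mulr_ile1 => //.
      by apply: mulr_ile1 => //; exact: boolr_norm_le1.
    have := channel_le1 (avW_ch (s t)) (cw i t) eta.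
    have := (avW_ch (s t)).1 (cw i t) eta.
    by rewrite ler_norml => ? ?; case: (z == eta); rewrite ?mulr1n ?mulr0n; apply/andP; split; lra.
  - move=> t; rewrite /dev.
    have [_ W1] := avW_ch (s t).
    rewrite (eq_bigr (fun z => (cw i t == a)%:R * (cw j t == b)%:R *
      ((z == eta)%:R * avW (s t) (cw i t) z - avW (s t) (cw i t) eta * avW (s t) (cw i t) z)));
      last by move=> z _; ring.
    by rewrite -mulr_sumr sumrB sum_ind_eq -mulr_sumr W1 mulr1 subrr mulr0.
  - by rewrite /e divr_gt0 ?mulr_gt0 ?exprn_gt0.
rewrite sumr_const !card_prod card_ord -[leLHS]mulr_natl.
by rewrite !natrM expr2 !mulrA.
Qed.

(** The first loss is the fraction of bad messages, the second the union bound for the others. *)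
Lemma success_block :
  1 - (2 * q ^+ 2 * #|S|%:R / d ^+ 2 / K%:R
       + K%:R / mR * (16 * q ^+ 6 * #|Y|%:R / dl ^+ 2))
  <= K%:R^-1 * \sum_i \sum_(y in decode_set i) nW s (cw i) y.
Proof.
have K0 : 0 < K%:R :> R by rewrite ltr0n.
have [nW0 nW1] := nW_channel s.
rewrite -(ler_pM2l K0) mulVKf ?gt_eqF //.
set c := K%:R / mR * _.
have cE : c = K%:R * q ^+ 2 * #|Y|%:R * (mR / e ^+ 2).
  by rewrite /c /e; field; rewrite !gt_eqF.
have c0 : 0 <= c by rewrite /c mulr_ge0 // divr_ge0 // ?mulr_ge0 ?exprn_ge0 // ltW.
apply: (@le_trans _ _ (\sum_(i < K) ((1 - c) - (bad i)%:R))).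
  rewrite sumrB sumr_const card_ord -[(1 - c) *+ K]mulr_natl.
  have -> : K%:R * (1 - (2 * q ^+ 2 * #|S|%:R / d ^+ 2 / K%:R + c)) =
     K%:R * (1 - c) - 2 * q ^+ 2 * #|S|%:R / d ^+ 2.
    by field; rewrite !gt_eqF.
  by rewrite lerD2l lerN2 card_bad.
apply: ler_sum => i _; case: (boolP (bad i)) => [_|gd] /=.
  apply: (@le_trans _ _ 0); first by lra.
  by apply: sumr_ge0.
by rewrite subr0 cE; exact: success_good.
Qed.

End Attack.

(** Double acceptance puts one and the same joint statistic within [dl / 2] of a [U]-average and of
    a [U']-average, which the symmetrizability gap forbids. *)
Lemma accept_unique (dl : R) (i j : 'I_K) (y : {ffun 'I_m -> Y}) :
  (forall U U' : X -> S -> R, is_channel U -> is_channel U' ->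
     ~ forall a b y, `|\sum_s U b s * avW s a y - \sum_s U' a s * avW s b y| <= dl) ->
  i != j -> accept dl i y -> accept dl j y -> False.
Proof.
move=> gap ij ai aj.
have [U [chU UP]] := ai j (negbT (negbTE (contra_neq (@esym _ _ _) ij))).
have [U' [chU' UP']] := aj i ij.
apply: (gap U U') => // a b eta.
have := UP a b eta; have := UP' b a eta.
have -> : \sum_t (cw j t == b)%:R * (cw i t == a)%:R * (y t == eta)%:R =
   \sum_t (cw i t == a)%:R * (cw j t == b)%:R * (y t == eta)%:R :> R.
  by apply: eq_bigr => t _; rewrite [_ * (cw i t == a)%:R]mulrC.
move: (_ * _) (\sum_s _) (\sum_s _) => u v z.
by rewrite !ler_norml => /andP[? ?] /andP[? ?]; apply/andP; split; lra.
Qed.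

Lemma block_prefix_code (dl : R) : 0 < dl ->
  (forall U U' : X -> S -> R, is_channel U -> is_channel U' ->
     ~ forall a b y, `|\sum_s U b s * avW s a y - \sum_s U' a s * avW s b y| <= dl) ->
  prefix_code A (#|X| ^ K) K
    (32 * q ^+ 6 * #|S|%:R ^+ 3 / dl ^+ 2 / K%:R
     + K%:R / (q ^+ K) * (16 * q ^+ 6 * #|Y|%:R / dl ^+ 2)).
Proof.
move=> dl0 gap; have -> : (#|X| ^ K)%N = m by rewrite card_ffun card_ord.
have S0 : 0 < #|S|%:R :> R by rewrite ltr0n; apply/card_gt0P; exists (avS_inh A).
exists 'I_K, cw, (fun i => [set y | `[< accept dl i y >]]); split.
- by rewrite card_ord.
- move=> i j ij; rewrite -setI_eq0; apply/eqP/setP => y; rewrite !inE.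
  by apply/negbTE/negP => /andP[/asboolP ai /asboolP aj]; exact: accept_unique gap ij ai aj.
- move=> s; pose d := dl / (4 * q ^+ 2 * #|S|%:R).
  have d0 : 0 < d by rewrite divr_gt0 ?mulr_gt0 ?exprn_gt0.
  have dE : q ^+ 2 * #|S|%:R * d = dl / 4 by rewrite /d; field; rewrite !gt_eqF.
  have := success_block s d0 dl0 dE; apply: le_trans.
  have mE : mR = q ^+ K by rewrite /mR card_ffun card_ord natrX.
  rewrite -mE le_eqVlt; apply/orP; left; apply/eqP; congr (1 - (_ + _)).
  rewrite /d; field.
  by rewrite (gt_eqF dl0) (gt_eqF S0) (gt_eqF q_gt0) pnatr_eq0 -lt0n K_gt0.
Qed.

End Block.

(** * Words over two consecutive time segments *)

Section Concatenation.
Variables (n1 n2 : nat).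

Definition lhalf (T : Type) (f : {ffun 'I_(n1 + n2) -> T}) : {ffun 'I_n1 -> T} :=
  [ffun i => f (lshift n2 i)].
Definition rhalf (T : Type) (f : {ffun 'I_(n1 + n2) -> T}) : {ffun 'I_n2 -> T} :=
  [ffun i => f (rshift n1 i)].
Definition fcat (T : Type) (f : {ffun 'I_n1 -> T}) (g : {ffun 'I_n2 -> T}) :
  {ffun 'I_(n1 + n2) -> T} :=
  [ffun i : 'I_(n1 + n2) => match fintype.split i with inl j => f j | inr j => g j end].

Lemma lhalf_fcat T (f : {ffun 'I_n1 -> T}) (g : {ffun 'I_n2 -> T}) : lhalf (fcat f g) = f.
Proof. by apply/ffunP => i; rewrite !ffunE (unsplitK (inl i)). Qed.

Lemma rhalf_fcat T (f : {ffun 'I_n1 -> T}) (g : {ffun 'I_n2 -> T}) : rhalf (fcat f g) = g.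
Proof. by apply/ffunP => i; rewrite !ffunE (unsplitK (inr i)). Qed.

Lemma fcat_halves T (f : {ffun 'I_(n1 + n2) -> T}) : fcat (lhalf f) (rhalf f) = f.
Proof. by apply/ffunP => i; rewrite ffunE; case: split_ordP => j ->; rewrite ffunE. Qed.

Lemma fcat_bij (T : Type) :
  bijective (fun p : {ffun 'I_n1 -> T} * {ffun 'I_n2 -> T} => fcat p.1 p.2).
Proof.
exists (fun f => (lhalf f, rhalf f)) => [[f g]|f] /=; last exact: fcat_halves.
by rewrite lhalf_fcat rhalf_fcat.
Qed.

Lemma sum_fcat (V : nmodType) (T : finType) (F : {ffun 'I_(n1 + n2) -> T} -> V) :
  \sum_f F f = \sum_f1 \sum_f2 F (fcat f1 f2).
Proof.
by rewrite pair_bigA /=; apply: reindex; exact: onW_bij (fcat_bij T).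
Qed.

Variables (R : realType) (A : AVWC R).

Lemma nW_fcat (s : {ffun 'I_(n1 + n2) -> avS A}) x1 x2 y1 y2 :
  nW s (fcat x1 x2) (fcat y1 y2) = nW (lhalf s) x1 y1 * nW (rhalf s) x2 y2.
Proof.
rewrite /nW big_split_ord /=; congr (_ * _); apply: eq_bigr => i _; rewrite !ffunE.
  by rewrite (unsplitK (inl i)).
by rewrite (unsplitK (inr i)).
Qed.

Lemma nV_fcat (s : {ffun 'I_(n1 + n2) -> avS A}) x1 x2 y1 y2 :
  nV s (fcat x1 x2) (fcat y1 y2) = nV (lhalf s) x1 y1 * nV (rhalf s) x2 y2.
Proof.
rewrite /nV big_split_ord /=; congr (_ * _); apply: eq_bigr => i _; rewrite !ffunE.
  by rewrite (unsplitK (inl i)).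
by rewrite (unsplitK (inr i)).
Qed.

End Concatenation.

(** * Prefix codes of sublinear length with polynomially many messages *)

Section PrefixConcatenation.
Variables (R : realType) (A : AVWC R).

Lemma avg_le1 (M : finType) (a : M -> R) : (forall l, a l <= 1) ->
  #|M|%:R^-1 * \sum_l a l <= 1.
Proof.
move=> a1; have [M0|M0] := posnP #|M|; first by rewrite M0 invr0 mul0r.
rewrite mulrC ler_pdivrMr ?ltr0n // mul1r -sumr_const; exact: ler_sum.
Qed.

Lemma prefix_code_weaken m L e e' : e <= e' ->
  prefix_code A m L e -> prefix_code A m L e'.
Proof.
move=> ee' [M [x [D [ML disj suc]]]]; exists M, x, D; split=> // s.
by apply: le_trans (suc s); rewrite lerD2l lerN2.
Qed.

Lemma prefix_code_nil : prefix_code A 0 1 0.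
Proof.
exists unit, (fun=> [ffun=> avX_inh A]), (fun=> [set: _]%SET); split.
- exact: card_unit.
- by move=> [] [].
- move=> s; rewrite subr0 invr1 mul1r (big_pred1 tt) ?le_eqVlt; last by case.
  apply/orP; left; apply/eqP; have [_ /(_ [ffun=> avX_inh A]) <-] := nW_channel s.
  by apply: eq_bigl => y; rewrite inE.
Qed.

(** The channel is memoryless and the pair of messages uniform, so the average successes multiply;
    for numbers at most 1 with deficits [e1] and [e2] the deficit of the product is at most
    [e1 + e2]. *)
Lemma prefix_code_cat m1 m2 L1 L2 e1 e2 :
  prefix_code A m1 L1 e1 -> prefix_code A m2 L2 e2 ->
  prefix_code A (m1 + m2) (L1 * L2) (e1 + e2).
Proof.
move=> [M1 [x1 [D1 [ML1 disj1 suc1]]]] [M2 [x2 [D2 [ML2 disj2 suc2]]]].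
exists (M1 * M2)%type, (fun l => fcat (x1 l.1) (x2 l.2)),
  (fun l => [set y | (lhalf y \in D1 l.1) && (rhalf y \in D2 l.2)]%SET); split.
- by rewrite card_prod ML1 ML2.
- move=> [l1 l2] [k1 k2]; rewrite xpair_eqE negb_and => lk.
  rewrite -setI_eq0; apply/eqP/setP => y; rewrite !inE /=.
  apply/negbTE/negP => /andP[/andP[yl1 yl2] /andP[yk1 yk2]].
  case/orP: lk => ne.
    by move: (disjointFr (disj1 _ _ ne) yl1); rewrite yk1.
  by move: (disjointFr (disj2 _ _ ne) yl2); rewrite yk2.
move=> s.
pose a l := \sum_(y in D1 l) nW (lhalf s) (x1 l) y.
pose b l := \sum_(y in D2 l) nW (rhalf s) (x2 l) y.
have -> : \sum_l \sum_(y in [set y | (lhalf y \in D1 l.1) && (rhalf y \in D2 l.2)]%SET)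
    nW s (fcat (x1 l.1) (x2 l.2)) y = (\sum_l a l) * (\sum_l b l).
  rewrite -(pair_bigA _ (fun l1 l2 => \sum_(y in [set y | (lhalf y \in D1 l1)
     && (rhalf y \in D2 l2)]%SET) nW s (fcat (x1 l1) (x2 l2)) y)) /= mulr_suml.
  apply: eq_bigr => l1 _; rewrite mulr_sumr; apply: eq_bigr => l2 _.
  rewrite big_mkcond sum_fcat /= /a [X in _ = X * _]big_mkcond [in RHS]mulr_suml; apply: eq_bigr => y1 _.
  rewrite /b [X in _ = _ * X]big_mkcond [in RHS]mulr_sumr; apply: eq_bigr => y2 _.
  rewrite inE lhalf_fcat rhalf_fcat nW_fcat.
  by case: (y1 \in _); case: (y2 \in _); rewrite ?mul0r ?mulr0.
have a1 : L1%:R^-1 * \sum_l a l <= 1.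
  rewrite -ML1; apply: avg_le1 => l; have [n0 ns] := nW_channel (lhalf s).
  by apply: sum_set_le1.
have b1 : L2%:R^-1 * \sum_l b l <= 1.
  rewrite -ML2; apply: avg_le1 => l; have [n0 ns] := nW_channel (rhalf s).
  by apply: sum_set_le1.
have -> : (L1 * L2)%:R^-1 * ((\sum_l a l) * \sum_l b l) =
   (L1%:R^-1 * \sum_l a l) * (L2%:R^-1 * \sum_l b l).
  by rewrite natrM invfM; ring.
move: (suc1 (lhalf s)) (suc2 (rhalf s)) a1 b1; rewrite -/a -/b.
by move: (_ * _) (_ * _) => u v; nra.
Qed.

Lemma prefix_code_iter B m L e :
  prefix_code A m L e -> prefix_code A (B * m) (L ^ B) (B%:R * e).
Proof.
move=> pc; elim: B => [|B IH]; first by rewrite mul0n mul0r; exact: prefix_code_nil.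
rewrite mulSn expnS -natr1 mulrDl mul1r addrC; exact: prefix_code_cat.
Qed.

Lemma sqr_le_expn K : (K ^ 2 <= 2 * 2 ^ K)%N.
Proof.
elim: K => // K; have [K2|K2] := leqP K 2; first by case: K K2 => [|[|[|]]].
move=> IH; rewrite (expnS 2 K); move: IH K2; rewrite -!mulnn.
by move: (2 ^ K)%N => u; nia.
Qed.

(** With a single input letter any [U] symmetrizes. Two letters make [q ^ K] grow exponentially. *)
Lemma nonsym_card : ~ symmetrizable A -> (1 < #|avX A|)%N.
Proof.
move=> nsym; rewrite ltnNge; apply/negP => /card_le1P X1; apply: nsym.
exists (fun _ s => (s == avS_inh A)%:R); split.
  split=> [x s|x]; first exact: boolr_ge0.
  rewrite -[RHS](sum_ind_eq (fun=> 1 : R) (avS_inh A)).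
  by apply: eq_bigr => s _; rewrite mulr1.
by move=> x x' y; have := X1 x isT x'; rewrite inE => /esym/eqP ->.
Qed.

(** Since [K ^ 2 <= 2 * 2 ^ K], the term with [K / q ^ K] is of order [1 / K] as well. *)
Lemma nonsym_block_codes : ~ symmetrizable A -> exists2 C : R, 0 < C &
  forall K, (0 < K)%N -> prefix_code A (#|avX A| ^ K) K (C / K%:R).
Proof.
move=> nsym; have [dl dl0 gap] := symmetrizability_gap nsym.
have X2 := nonsym_card nsym.
set q : R := #|avX A|%:R.
have q0 : 0 < q by rewrite ltr0n ltnW.
have S0 : 0 < #|avS A|%:R :> R by rewrite ltr0n; apply/card_gt0P; exists (avS_inh A).
pose c1 := 32 * q ^+ 6 * #|avS A|%:R ^+ 3 / dl ^+ 2.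
pose c2 := 16 * q ^+ 6 * #|avY A|%:R / dl ^+ 2.
have c10 : 0 < c1 by rewrite /c1 !(divr_gt0, mulr_gt0, exprn_gt0).
have c20 : 0 <= c2 by rewrite /c2 divr_ge0 ?mulr_ge0 ?exprn_ge0 // ltW.
exists (c1 + 2 * c2); first by lra.
move=> K K0; apply: prefix_code_weaken (block_prefix_code K0 dl0 gap).
have K0' : 0 < K%:R :> R by rewrite ltr0n.
rewrite -/q -/c1 -/c2 mulrDl lerD2l [leRHS]mulrAC; apply: ler_wpM2r => //.
rewrite ler_pdivrMr ?exprn_gt0 // mulrAC ler_pdivlMr //.
apply: (@le_trans _ _ (2 * 2 ^ K)%:R).
  by rewrite -natrM ler_nat mulnn sqr_le_expn.
by rewrite natrM ler_pM2l // natrX /q lerXn2r // ?nnegrE ?ler0n // ler_nat.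
Qed.

(** Concatenate [B] blocks, [B] being about [K / M]. The errors add up to at most [2 C / M <= eps],
    the length [B * q ^ K] is of order [K] times the square root of [N], and there are [K ^ B]
    messages. *)
Lemma nonsym_prefix_codes (eps : R) : ~ symmetrizable A -> 0 < eps ->
  exists N0, forall N, (N0 <= N)%N -> exists m L,
    [/\ prefix_code A m L eps, m%:R <= eps * N%:R & (N ^ 4 <= L)%N].
Proof.
move=> nsym eps0; have [C C0 blocks] := nonsym_block_codes nsym.
have X2 := nonsym_card nsym.
set q := #|avX A| in blocks X2 *.
pose M := (Num.bound (2 * C / eps)).+1.
have M0 : (0 < M)%N by [].
have ML : 2 * C / eps <= M%:R.
  apply: (le_trans (ltW (archi_boundP _))); last by rewrite ler_nat.
  by rewrite divr_ge0 ?mulr_ge0 ?ltW.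
(* Three demands on [K]: at least [q ^ (16 * M)] to make [K ^ B] reach [N ^ 4], at least [M] to have
   [B * M <= 2 * K], and at least [4 / eps] to keep the length below [eps * N]. *)
pose K0 := maxn (q ^ (16 * M)) (maxn M (Num.bound (4 / eps))).
exists (q ^ (2 * K0.+1))%N => N NN0.
have N0 : (0 < N)%N by apply: leq_trans NN0; rewrite expn_gt0 (ltnW X2).
have q2 : (1 < q ^ 2)%N by rewrite -(exp1n 2) ltn_exp2r.
have /andP[qN Nq] := trunc_log_bounds q2 N0.
(* The base [q ^ 2] keeps the length [q ^ K] of one block below the square root of [N]. *)
set K := trunc_log (q ^ 2) N in qN Nq.
have KK0 : (K0 <= K)%N.
  rewrite -ltnS -(ltn_exp2l _ _ q2); apply: leq_ltn_trans Nq.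
  by rewrite -expnM; apply: leq_trans NN0; rewrite leq_exp2l //; lia.
move: KK0; rewrite !geq_max => /and3P[KqM KM Keps].
have K1 : (0 < K)%N by apply: leq_trans KM.
have K1' : 0 < K%:R :> R by rewrite ltr0n.
have M0' : 0 < M%:R :> R by rewrite ltr0n.
pose B := (K %/ M).+1.
have BM : (K <= B * M)%N by rewrite ltnW // ltn_ceil.
have BM2 : (B * M <= 2 * K)%N.
  have := leq_trunc_div K M; rewrite /B mulSn; move: KM.
  by move: (K %/ M * M)%N => u; lia.
have B2 : (B <= 2 * K)%N by apply: leq_trans BM2; rewrite leq_pmulr.
exists (B * q ^ K)%N, (K ^ B)%N; split.
- apply: prefix_code_weaken (prefix_code_iter B (blocks K K1)).
  rewrite mulrA ler_pdivrMr //.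
  have : B%:R * M%:R <= 2 * K%:R :> R by rewrite -!natrM ler_nat.
  move: ML; rewrite ler_pdivrMr // => ML BM2'.
  have B0 : 0 <= B%:R :> R by [].
  rewrite -(ler_pM2r M0').
  by move: (B%:R) (M%:R) (K%:R) B0 M0' K1' ML BM2' => b mm k; nra.
- have Keps' : 4 <= eps * K%:R.
    rewrite -ler_pdivrMl // mulrC; apply: (le_trans (ltW (archi_boundP _))).
      by rewrite divr_ge0 // ltW.
    by rewrite ler_nat.
  have qK0 : 0 < (q ^ K)%:R :> R by rewrite ltr0n expn_gt0 (ltnW X2).
  have Kq : K%:R * K%:R <= 2 * (q ^ K)%:R :> R.
    rewrite -!natrM ler_nat mulnn; apply: leq_trans (sqr_le_expn K) _.
    by rewrite leq_mul2l leq_exp2r.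
  have NqK : (q ^ K)%:R * (q ^ K)%:R <= N%:R :> R.
    by rewrite -natrM ler_nat mulnn -expnM mulnC expnM.
  have B2' : B%:R <= 2 * K%:R :> R by rewrite -natrM ler_nat.
  apply: (@le_trans _ _ (eps * ((q ^ K)%:R * (q ^ K)%:R))); last by rewrite ler_pM2l.
  rewrite natrM mulrA ler_pM2r //.
  by move: (B%:R) (K%:R) ((q ^ K)%:R : R) K1' qK0 Keps' Kq B2' => b k u; nra.
- apply: (@leq_trans (q ^ (16 * M * B))); last first.
    by rewrite expnM leq_exp2r.
  apply: (@leq_trans (q ^ (8 * K.+1))).
    have -> : (q ^ (8 * K.+1) = ((q ^ 2) ^ K.+1) ^ 4)%N.
      by rewrite -!expnM; congr expn; lia.
    by rewrite leq_exp2r // ltnW.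
  by rewrite leq_exp2l //; move: BM K1; clear; nia.
Qed.

End PrefixConcatenation.

(** * Elimination of common randomness *)

Section CodeFacts.
Variable R : realType.

Lemma avg_le_bound (M : finType) (a : M -> R) (b : R) : (0 < #|M|)%N ->
  (forall l, a l <= b) -> #|M|%:R^-1 * \sum_l a l <= b.
Proof.
move=> M0 ab; rewrite mulrC ler_pdivrMr ?ltr0n // mulr_natr -sumr_const.
exact: ler_sum.
Qed.

Lemma ord_eq1 (n : nat) (i j : 'I_n) : n = 1%N -> i = j.
Proof. by move=> n1; move: i j; rewrite n1 => i j; rewrite !ord1. Qed.

Section Fixed.
Variables (A : AVWC R) (n : nat) (c : Defs.code A n).

Lemma cK_gt0R : 0 < (cK c)%:R :> R.
Proof. by rewrite ltr0n cK_gt0. Qed.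

Lemma cG_gt0R : 0 < (cG c)%:R :> R.
Proof. by rewrite ltr0n cG_gt0. Qed.

(** Success probability conditional on the common randomness [g], as [gjoint] is the conditional law
    of message and Eve's output; error and conditional leakage are governed by averages over [g]. *)
Definition gsucc (s : {ffun 'I_n -> avS A}) (g : 'I_(cG c)) : R :=
  (cK c)%:R^-1 * \sum_(k : 'I_(cK c)) \sum_(x : {ffun 'I_n -> avX A})
     cE g k x * \sum_(y in cD g k) nW s x y.

Definition gjoint (s : {ffun 'I_n -> avS A}) (g : 'I_(cG c)) (k : 'I_(cK c))
    (z : {ffun 'I_n -> avZ A}) : R :=
  (cK c)%:R^-1 * \sum_(x : {ffun 'I_n -> avX A}) cE g k x * nV s x z.

Lemma success_mean s : success c s = (cG c)%:R^-1 * \sum_g gsucc s g.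
Proof.
by rewrite /success /gsucc -mulr_sumr mulrA natrM invfM [_ * (cG c)%:R^-1]mulrC.
Qed.

Lemma jointKGZ_gjoint s k g z : jointKGZ s k g z = (cG c)%:R^-1 * gjoint s g k z.
Proof. by rewrite /jointKGZ /gjoint natrM invfM mulrA [_^-1 * _]mulrC. Qed.

Lemma gjoint_ge0 s g k z : 0 <= gjoint s g k z.
Proof.
have [V0 _] := nV_channel s; have [E0 _] := cE_ch g.
apply: mulr_ge0; first by rewrite invr_ge0 ltW // cK_gt0R.
by apply: sumr_ge0 => x _; rewrite mulr_ge0.
Qed.

Lemma gjoint_marg s g k : \sum_z gjoint s g k z = (cK c)%:R^-1.
Proof.
have [_ V1] := nV_channel s; have [_ E1] := cE_ch g.
rewrite -mulr_sumr exchange_big /= -[RHS]mulr1 -(E1 k); congr (_ * _).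
by apply: eq_bigr => x _; rewrite -mulr_sumr V1 mulr1.
Qed.

Lemma gjoint_total s g : \sum_k \sum_z gjoint s g k z = 1.
Proof.
under eq_bigr do rewrite gjoint_marg.
by rewrite sumr_const card_ord -[LHS]mulr_natr mulVf // gt_eqF // cK_gt0R.
Qed.

(** The common randomness is uniform, so the factors [1 / cG c] of the joint masses and of the
    marginal of [g] cancel inside the logarithm. *)
Lemma leakCMI_mean s : leakCMI c s = (cG c)%:R^-1 * \sum_g MI (gjoint s g).
Proof.
have G0 := cG_gt0R; have G0' : (cG c)%:R^-1 != 0 :> R by rewrite gt_eqF // invr_gt0.
rewrite /leakCMI /CMI.
under eq_bigr => k _ do rewrite exchange_big /=.
rewrite exchange_big /= mulr_sumr; apply: eq_bigr => g _.
rewrite mulr_sumr; apply: eq_bigr => k _; rewrite mulr_sumr; apply: eq_bigr => z _.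
have -> : \sum_k' \sum_z' jointKGZ s k' g z' = (cG c)%:R^-1.
  under eq_bigr do under eq_bigr do rewrite jointKGZ_gjoint.
  under eq_bigr do rewrite -mulr_sumr.
  by rewrite -mulr_sumr gjoint_total mulr1.
under [\sum_z' jointKGZ s k g z']eq_bigr do rewrite jointKGZ_gjoint.
under [\sum_k' jointKGZ s k' g z]eq_bigr do rewrite jointKGZ_gjoint.
rewrite jointKGZ_gjoint -!mulr_sumr -[LHS]mulrA; congr (_ * (_ * log2 _)).
by rewrite [X in X / _]mulrAC [X in _ / X]mulrACA -mulf_div divff ?mulf_neq0 // mul1r.
Qed.

Lemma leakMI_single s (g : 'I_(cG c)) : cG c = 1%N -> leakMI c s = MI (gjoint s g).
Proof.
move=> G1; apply: MI_eq => k z.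
have all_g (g' : 'I_(cG c)) : g' = g by exact: ord_eq1.
rewrite (big_pred1 g); last by move=> g' /=; rewrite (all_g g') eqxx.
by rewrite jointKGZ_gjoint G1 invr1 mul1r.
Qed.

Lemma leakCMI_single s : cG c = 1%N -> leakCMI c s = leakMI c s.
Proof.
move=> G1; rewrite leakCMI_mean; have -> : (cG c)%:R = 1 :> R by rewrite G1.
rewrite invr1 mul1r.
have g : 'I_(cG c) by rewrite G1; exact: ord0.
rewrite (leakMI_single s g) //.
have all_g (g' : 'I_(cG c)) : g' = g by exact: ord_eq1.
by rewrite (big_pred1 g) // => g' /=; rewrite (all_g g') eqxx.
Qed.

Lemma gsucc_ge0 s g : 0 <= gsucc s g.
Proof.
have [W0 _] := nW_channel s; have [E0 _] := cE_ch g.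
apply: mulr_ge0; first by rewrite invr_ge0 ltW // cK_gt0R.
apply: sumr_ge0 => k _; by rewrite sumr_ge0 // => x _; rewrite mulr_ge0 // sumr_ge0.
Qed.

Lemma gsucc_le1 s g : gsucc s g <= 1.
Proof.
have [W0 W1] := nW_channel s; have [E0 E1] := cE_ch g.
rewrite /gsucc mulrC ler_pdivrMr ?cK_gt0R // mul1r -[X in _ <= X%:R](card_ord (cK c)) -sumr_const.
apply: ler_sum => k _; rewrite -(E1 k); apply: ler_sum => x _.
by rewrite -[leRHS]mulr1 ler_wpM2l // sum_set_le1.
Qed.

(** Each output word lies in at most one decoding set and is counted there with weight at most 1. *)
Lemma gsucc_card s g : (cK c)%:R * gsucc s g <= (#|avY A| ^ n)%:R.
Proof.
have [W0 W1] := nW_channel s; have [E0 E1] := cE_ch g.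
rewrite mulVKf ?gt_eqF ?cK_gt0R //.
apply: (@le_trans _ _ (\sum_k \sum_(y in cD g k) (1 : R))).
  apply: ler_sum => k _.
  under eq_bigr do rewrite mulr_sumr.
  rewrite exchange_big /=; apply: ler_sum => y _; rewrite -(E1 k).
  apply: ler_sum => x _; rewrite -[leRHS]mulr1 ler_wpM2l //.
  exact: channel_le1 (nW_channel s) _ _.
have -> : (#|avY A| ^ n)%:R = \sum_(y : {ffun 'I_n -> avY A}) (1 : R).
  by rewrite sumr_const card_ffun card_ord.
rewrite (exchange_big_dep xpredT) //=; apply: ler_sum => y _.
rewrite big_mkcond /=; have [[k yk]|nk] := pselect (exists k, y \in cD g k).
  rewrite (bigD1 k) //= yk big1 ?addr0 // => k' kk'.
  by rewrite (disjointFl (cD_disj g kk') yk).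
by rewrite big1 ?ler01 // => k _; case: ifP => // yk; case: nk; exists k.
Qed.

Lemma error_ge0 : 0 <= error c.
Proof. exact: bigmax_ge_id. Qed.

Lemma error_ub s : 1 - success c s <= error c.
Proof. exact: (le_bigmax _ (fun s => 1 - success c s)). Qed.

Lemma error_lub e : 0 <= e -> (forall s, 1 - e <= success c s) -> error c <= e.
Proof.
by move=> e0 es; apply: bigmax_le => // s _; have := es s; lra.
Qed.

Lemma max_leakMI_ge0 : 0 <= max_leakMI c.
Proof. exact: bigmax_ge_id. Qed.

Lemma leakMI_ub s : leakMI c s <= max_leakMI c.
Proof. exact: (le_bigmax _ (fun s => leakMI c s)). Qed.

Lemma max_leakMI_lub e : 0 <= e -> (forall s, leakMI c s <= e) -> max_leakMI c <= e.
Proof. by move=> e0 es; apply: bigmax_le. Qed.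

Lemma max_leakCMI_ge0 : 0 <= max_leakCMI c.
Proof. exact: bigmax_ge_id. Qed.

Lemma leakCMI_ub s : leakCMI c s <= max_leakCMI c.
Proof. exact: (le_bigmax _ (fun s => leakCMI c s)). Qed.

Lemma max_leakCMI_lub e : 0 <= e -> (forall s, leakCMI c s <= e) -> max_leakCMI c <= e.
Proof. by move=> e0 es; apply: bigmax_le. Qed.

Lemma max_leakCMI_single : cG c = 1%N -> max_leakCMI c = max_leakMI c.
Proof. by move=> G1; apply: eq_bigr => s _; exact: leakCMI_single. Qed.

Lemma code_size : error c <= 1 / 2 -> (cK c)%:R <= 2 * (#|avY A| ^ n)%:R :> R.
Proof.
move=> err; have s : {ffun 'I_n -> avS A} := [ffun=> avS_inh A].
have suc : 1 / 2 <= success c s by have := error_ub s; lra.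
have K0 := cK_gt0R.
have : (cK c)%:R * success c s <= (#|avY A| ^ n)%:R.
  rewrite success_mean mulrCA mulr_sumr -{1}(card_ord (cG c)).
  apply: avg_le_bound => [|g]; first by rewrite card_ord cG_gt0.
  exact: gsucc_card.
by nra.
Qed.

Lemma log2_cK_ge0 : 0 <= log2 (cK c)%:R :> R.
Proof. by apply: log2_ge0; rewrite ler1n cK_gt0. Qed.

(* [1 + log2 #|Y|] per letter absorbs the factor 2 for every nonzero blocklength. *)
Lemma log2_code_size : error c <= 1 / 2 -> (0 < n)%N ->
  log2 (cK c)%:R <= n%:R * (1 + log2 (#|avY A|.+1)%:R) :> R.
Proof.
move=> err n0; apply: (@le_trans _ _ (log2 ((2 * #|avY A|.+1)%:R ^+ n))).
  apply: ler_log2 cK_gt0R _; apply: le_trans (code_size err) _.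
  rewrite -natrX -natrM ler_nat expnMn; apply: leq_mul; first by rewrite -{1}(expn1 2) leq_exp2l.
  by rewrite leq_exp2r.
rewrite /log2 lnXn ?ltr0n // natrM lnM ?posrE ?ltr0n // -[_ *+ n]mulr_natl.
by rewrite -mulrA mulrDl divff ?gt_eqF ?ln2_gt0.
Qed.

Lemma gjoint_MI_ge0 s g : 0 <= MI (gjoint s g).
Proof. by apply: MI_ge0; [exact: gjoint_ge0|exact: gjoint_total]. Qed.

Lemma gjoint_MI_le s g : MI (gjoint s g) <= log2 (cK c)%:R.
Proof.
have := @MI_le_log_card R _ _ (gjoint s g) (gjoint_ge0 s g); rewrite card_ord; apply.
  exact: cK_gt0.
exact: gjoint_marg.
Qed.

End Fixed.

(* Send [l] in clear by the prefix code, then use the code [gam l]. *)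
Section Elimination.
Variables (A : AVWC R) (n1 n2 : nat) (c : Defs.code A n2) (M : finType).
Variables (xp : M -> {ffun 'I_n1 -> avX A}) (Dp : M -> {set {ffun 'I_n1 -> avY A}}).
Variable gam : M -> 'I_(cG c).
Hypothesis M_gt0 : (0 < #|M|)%N.
Hypothesis Dp_disj : forall l l', l != l' -> [disjoint Dp l & Dp l'].

Let M_gt0R : 0 < #|M|%:R :> R. Proof. by rewrite ltr0n. Qed.

(** The index [l] is drawn inside the stochastic encoder, so the new code has no common randomness
    left. *)
Let E (_ : 'I_1) (k : 'I_(cK c)) (x : {ffun 'I_(n1 + n2) -> avX A}) : R :=
  #|M|%:R^-1 * \sum_l (lhalf x == xp l)%:R * cE (gam l) k (rhalf x).

Let D (_ : 'I_1) (k : 'I_(cK c)) : {set {ffun 'I_(n1 + n2) -> avY A}} :=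
  [set y | [exists l, (lhalf y \in Dp l) && (rhalf y \in cD (gam l) k)]]%SET.

Let sum_E g k (F : {ffun 'I_(n1 + n2) -> avX A} -> R) :
  \sum_x E g k x * F x =
  #|M|%:R^-1 * \sum_l \sum_x2 cE (gam l) k x2 * F (fcat (xp l) x2).
Proof.
rewrite sum_fcat.
have -> : \sum_f1 \sum_f2 E g k (fcat f1 f2) * F (fcat f1 f2) =
   \sum_f1 #|M|%:R^-1 * \sum_l (f1 == xp l)%:R *
      \sum_f2 cE (gam l) k f2 * F (fcat f1 f2).
  apply: eq_bigr => f1 _; rewrite /E.
  under eq_bigr => f2 _ do rewrite lhalf_fcat rhalf_fcat -mulrA mulr_suml.
  rewrite -mulr_sumr exchange_big /=; congr (_ * _); apply: eq_bigr => l _.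
  by rewrite mulr_sumr; apply: eq_bigr => f2 _; rewrite mulrA.
rewrite -mulr_sumr exchange_big /=; congr (_ * _); apply: eq_bigr => l _.
exact: (sum_ind_eq (fun f1 => \sum_f2 cE (gam l) k f2 * F (fcat f1 f2))).
Qed.

Let E_ch g : is_channel (E g).
Proof.
split=> [k x|k].
  apply: mulr_ge0; first by rewrite invr_ge0 ltW.
  apply: sumr_ge0 => l _; by have [E0 _] := cE_ch (gam l); rewrite mulr_ge0 // boolr_ge0.
under eq_bigr do rewrite -[E _ _ _]mulr1.
rewrite (sum_E g k (fun=> 1)).
under eq_bigr => l _.
  under eq_bigr do rewrite mulr1.
  have [_ ->] := cE_ch (gam l); over.
by rewrite sumr_const mulVf // gt_eqF.
Qed.

Let D_disj g k k' : k != k' -> [disjoint D g k & D g k'].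
Proof.
move=> kk'; rewrite -setI_eq0; apply/eqP/setP => y; rewrite !inE.
apply/negbTE/negP => /andP[/existsP[l /andP[yl yk]] /existsP[l' /andP[yl' yk']]].
have [ll'|ll'] := eqVneq l l'; last by rewrite (disjointFr (Dp_disj ll') yl) in yl'.
by rewrite -ll' (disjointFr (cD_disj (gam l) kk') yk) in yk'.
Qed.

Definition elim_code : Defs.code A (n1 + n2) :=
  @MkCode R A (n1 + n2) (cK c) 1 (cK_gt0 c) isT E E_ch D D_disj.

(** Given [l], prefix and payload succeed independently, and [a * b >= a + b - 1] on the unit
    interval. *)
Lemma elim_success s :
  #|M|%:R^-1 * (\sum_l \sum_(y in Dp l) nW (lhalf s) (xp l) y)
  + #|M|%:R^-1 * (\sum_l gsucc (rhalf s) (gam l)) - 1 <= success elim_code s.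
Proof.
have [W0 W1] := nW_channel s.
have [Wl0 Wl1] := nW_channel (lhalf s); have [Wr0 Wr1] := nW_channel (rhalf s).
pose a l := \sum_(y in Dp l) nW (lhalf s) (xp l) y.
apply: (@le_trans _ _ (#|M|%:R^-1 * \sum_l a l * gsucc (rhalf s) (gam l))).
  rewrite -mulrDr -[X in _ - X](mulVf (lt0r_neq0 M_gt0R)) -mulrBr.
  rewrite ler_pM2l ?invr_gt0 // -sumr_const -big_split -sumrB /=; apply: ler_sum => l _.
  have : a l <= 1 by apply: sum_set_le1.
  by have := gsucc_le1 (rhalf s) (gam l); rewrite /a; nra.
rewrite success_mean /= big_ord1 invr1 mul1r /gsucc /=.
rewrite -(ler_pM2l (cK_gt0R c)) mulVKf ?(lt0r_neq0 (cK_gt0R c)) //.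
under [in leRHS]eq_bigr => k _ do
  rewrite (sum_E ord0 k (fun x => \sum_(y in D ord0 k) nW s x y)).
rewrite -[leRHS]mulr_sumr [leLHS]mulrCA ler_pM2l ?invr_gt0 // [leRHS]exchange_big mulr_sumr /=.
apply: ler_sum => l _; rewrite mulrCA mulVKf ?(lt0r_neq0 (cK_gt0R c)) // mulr_sumr.
apply: ler_sum => k _; rewrite mulr_sumr; apply: ler_sum => x2 _.
have [E0 _] := cE_ch (gam l); rewrite mulrCA; apply: ler_wpM2l => //.
rewrite [leRHS]big_mkcond sum_fcat /a mulr_suml big_mkcond; apply: ler_sum => y1 _.
case: ifPn => [y1l|_]; last by apply: sumr_ge0 => y2 _; case: ifP.
rewrite mulr_sumr big_mkcond; apply: ler_sum => y2 _.
case: ifPn => [y2k|_]; last by case: ifP.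
rewrite nW_fcat ifT // inE; apply/existsP; exists l.
by rewrite lhalf_fcat rhalf_fcat y1l.
Qed.

(** Eve's view of the prefix depends only on [l], which is uniform and independent of the message;
    even full knowledge of [l] leaves the average of the individual leakages. *)
Lemma elim_leak s :
  leakMI elim_code s <= #|M|%:R^-1 * \sum_l MI (gjoint (rhalf s) (gam l)).
Proof.
rewrite (leakMI_single s (ord0 : 'I_(cG elim_code))) //.
rewrite -(MI_reindex _ (fcat_bij n1 n2 (avZ A))).
apply: (@MI_mixture R M _ _ _ (fun l => nV (lhalf s) (xp l))
          (fun l => gjoint (rhalf s) (gam l)) (cK c)%:R^-1) => //.
- by rewrite invr_gt0 cK_gt0R.
- by have [] := nV_channel (lhalf s).
- by have [] := nV_channel (lhalf s).
- by move=> l; exact: gjoint_ge0.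
- by move=> l; exact: gjoint_marg.
move=> k [z1 z2]; rewrite /gjoint /= (sum_E ord0 k (fun x => nV s x (fcat z1 z2))).
rewrite mulrCA; congr (_ * _); rewrite mulr_sumr; apply: eq_bigr => l _.
rewrite mulrCA; congr (_ * _); rewrite mulr_sumr; apply: eq_bigr => x2 _.
by rewrite nV_fcat mulrCA.
Qed.

End Elimination.
End CodeFacts.

(** * Capacities *)

Section Limits.
Variable R : realType.
Implicit Types u : nat -> R.

Lemma limn_einf_sup_inf (v : nat -> \bar R) :
  limn_einf v = ereal_sup (range (einfs v)).
Proof.
rewrite limn_einf_lim; apply/cvg_lim => //.
exact: ereal_nondecreasing_cvgn (nondecreasing_einfs v).
Qed.

Lemma limn_einf_ge u (r : R) :
  (forall e, 0 < e -> exists N, forall n, (N <= n)%N -> r - e <= u n) ->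
  (r%:E <= limn_einf (fun n => (u n)%:E))%E.
Proof.
move=> H; apply/lee_subgt0Pr => e e0; have [N HN] := H e e0.
rewrite limn_einf_sup_inf -EFinB.
apply: (@le_trans _ _ (einfs (fun n => (u n)%:E) N)).
  by apply: le_ereal_inf_tmp => _ [n /= Nn <-]; rewrite lee_fin HN.
by apply: ereal_sup_ubound; exists N.
Qed.

Lemma limn_einf_le u (r : R) :
  (exists N, forall n, (N <= n)%N -> u n <= r) ->
  (limn_einf (fun n => (u n)%:E) <= r%:E)%E.
Proof.
move=> [N HN]; rewrite limn_einf_sup_inf; apply: ub_ereal_sup => _ [n _ <-].
apply: (@le_trans _ _ (u (maxn n N))%:E); last by rewrite lee_fin HN // leq_maxr.
by apply: ereal_inf_lbound; exists (maxn n N) => //=; rewrite leq_maxl.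
Qed.

Lemma limn_einf_eventually u (r : R) : limn_einf (fun n => (u n)%:E) = r%:E ->
  forall e, 0 < e -> exists N, forall n, (N <= n)%N -> r - e <= u n.
Proof.
rewrite limn_einf_sup_inf => lim e e0.
have : ((r - e)%:E < ereal_sup (range (einfs (fun n => (u n)%:E))))%E.
  by rewrite lim lte_fin ltrBlDr ltrDl.
move/ereal_sup_gt => [_ [N _ <-] lt]; exists N => n Nn.
rewrite -lee_fin; apply: le_trans (ltW lt) _.
by apply: ereal_inf_lbound; exists n.
Qed.

Lemma limn_esup_0 u : (forall n, 0 <= u n) ->
  (forall e, 0 < e -> exists N, forall n, (N <= n)%N -> u n <= e) ->
  limn_esup (fun n => (u n)%:E) = 0%E.
Proof.
move=> u0 H; suff cv : ((fun n => (u n)%:E) @ \oo --> 0%E)%classic.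
  by have [_ ->] := cvg_limn_einf_sup cv.
apply: cvg_EFin; first exact: nearW.
apply/cvgrPdist_le => e e0; have [N HN] := H e e0; near=> n.
rewrite sub0r normrN ger0_norm //=; apply: HN; near: n; exact: nbhs_infty_ge.
Unshelve. all: by end_near. Qed.

Lemma limn_esup_0_eventually u : (forall n, 0 <= u n) ->
  limn_esup (fun n => (u n)%:E) = 0%E ->
  forall e, 0 < e -> exists N, forall n, (N <= n)%N -> u n <= e.
Proof.
move=> u0 lim e e0.
have : ((fun n => (u n)%:E) @ \oo --> 0%E)%classic.
  by apply: limn_esup_le_cvg => [|n]; rewrite ?lim // lee_fin.
move/fine_cvgP => [_ /cvgrPdist_le/(_ e e0)][N _ HN]; exists N => n Nn.
by have := HN n Nn; rewrite /= sub0r normrN ger0_norm.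
Qed.

Lemma cvg0_eventually u : (forall n, 0 <= u n) ->
  ((u : nat -> R) @ \oo --> (0 : R))%classic <->
  forall e, 0 < e -> exists N, forall n, (N <= n)%N -> u n <= e.
Proof.
move=> u0; split=> [/cvgrPdist_le H e e0|H].
  have [N _ HN] := H e e0; exists N => n Nn.
  by have := HN n Nn; rewrite /= sub0r normrN ger0_norm.
apply/cvgrPdist_le => e e0; have [N HN] := H e e0; near=> n.
rewrite sub0r normrN ger0_norm //; apply: HN; near: n; exact: nbhs_infty_ge.
Unshelve. all: by end_near. Qed.

End Limits.

(** * From good codes at all large blocklengths to lower bounds on capacities *)

Section Capacities.
Variable R : realType.

Section GoodSequence.
Variable A : AVWC R.
Variables (P : forall n, Defs.code A n -> Prop) (lk : forall n, Defs.code A n -> R).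
Variable r : R.

Let rate n (c : Defs.code A n) : R := log2 (cK c)%:R / n%:R.

(** The class [P] of codes and the leakage [lk] are parameters, so that one diagonal argument serves
    both capacities. *)
Let good n (c : Defs.code A n) (e : R) : Prop :=
  [/\ P c, error c <= e, lk c <= e & r - e <= rate c].

Hypothesis lk_ge0 : forall n (c : Defs.code A n), 0 <= lk c.
Hypothesis P_ex : forall n, exists c : Defs.code A n, P c.
Hypothesis good_ex : forall e, 0 < e ->
  exists N, forall n, (N <= n)%N -> exists c : Defs.code A n, good c e.

Let good_weaken n (c : Defs.code A n) e e' : e <= e' -> good c e -> good c e'.
Proof. by move=> ee' [Pc er lkc rt]; split=> //; lra. Qed.

(* Diagonal choice: at blocklength [n] take a code of the best quality [1 / (k + 1)]
   with [k <= n]. *)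
Let best_code n : exists c : Defs.code A n, P c /\
  forall k, (k <= n)%N -> (exists c', @good n c' k.+1%:R^-1) -> good c k.+1%:R^-1.
Proof.
pose Q k := (k <= n)%N && `[< exists c' : Defs.code A n, good c' k.+1%:R^-1 >].
have [exQ|nQ] := pselect (exists k, Q k); last first.
  have [c Pc] := P_ex n; exists c; split=> // k kn ex; case: nQ; exists k.
  by rewrite /Q kn; apply/asboolP.
have Qn k : Q k -> (k <= n)%N by case/andP.
case: (ex_maxnP exQ Qn) => k /andP[kn /asboolP[c gc]] kmax.
exists c; split=> [|j jn ex]; first by case: gc.
apply: good_weaken gc; rewrite lef_pV2 ?posrE ?ltr0n // ler_nat ltnS.
by apply: kmax; rewrite /Q jn; apply/asboolP.
Qed.

(** The lower limit of the rates may exceed [r], hence [r']. It is a real number because codes of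
    small error have bounded rate. *)
Lemma good_sequence : exists c : forall n, Defs.code A n,
  [/\ forall n, P (c n), ((fun n => error (c n)) @ \oo --> (0 : R))%classic,
      (exists2 r', r <= r' & rate_of c = r'%:E) &
      limn_esup (fun n => (lk (c n))%:E) = 0%E].
Proof.
pose c n := projT1 (cid (best_code n)).
have cP n : P (c n) by case: (projT2 (cid (best_code n))).
have cbest n : forall k, (k <= n)%N -> (exists c', @good n c' k.+1%:R^-1) ->
    good (c n) k.+1%:R^-1 by case: (projT2 (cid (best_code n))).
have ev e : 0 < e -> exists N, forall n, (N <= n)%N -> good (c n) e.
  move=> e0; pose k := Num.bound e^-1.
  have ke : k.+1%:R^-1 <= e.
    rewrite -[leRHS]invrK lef_pV2 ?posrE ?ltr0n ?invr_gt0 //.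
    apply: (le_trans (ltW (archi_boundP _))); first by rewrite invr_ge0 ltW.
    by rewrite ler_nat.
  have k0 : 0 < k.+1%:R^-1 :> R by rewrite invr_gt0.
  have [N HN] := good_ex k0; exists (maxn N k) => n; rewrite geq_max => /andP[Nn kn].
  by apply: good_weaken ke _; apply: cbest kn (HN n Nn).
exists c; split=> //.
- apply/cvg0_eventually => [n|e e0]; first exact: error_ge0.
  by have [N HN] := ev e e0; exists N => n /HN[].
- have ge_r : (r%:E <= rate_of c)%E.
    by apply: limn_einf_ge => e /ev[N HN]; exists N => n /HN[].
  have le_b : (rate_of c <= (1 + log2 (#|avY A|.+1)%:R)%:E)%E.
    have h : 0 < 1 / 2 :> R by lra.
    apply: limn_einf_le; have [N HN] := ev _ h; exists (maxn N 1) => n.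
    rewrite geq_max => /andP[/HN[_ err _ _] n0].
    by rewrite ler_pdivrMr ?ltr0n // mulrC; exact: log2_code_size.
  move: ge_r le_b; case: (rate_of c) => [r'| |] // rr' _.
  by exists r'.
- by apply: limn_esup_0 => // e e0; have [N HN] := ev e e0; exists N => n /HN[].
Qed.

End GoodSequence.

Variable A : AVWC R.

(** A filler for blocklengths without a good code, and the reason why the capacities are
    nonnegative. *)
Lemma trivial_code n : exists c : Defs.code A n,
  [/\ cK c = 1%N, cG c = 1%N, error c = 0 & max_leakMI c = 0].
Proof.
pose x0 : {ffun 'I_n -> avX A} := [ffun=> avX_inh A].
pose E (_ _ : 'I_1) (x : {ffun 'I_n -> avX A}) : R := (x == x0)%:R.
have Ech g : is_channel (E g).
  split=> [k x|k]; first exact: boolr_ge0.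
  rewrite -[RHS](sum_ind_eq (fun=> 1 : R) x0).
  by apply: eq_bigr => x _; rewrite mulr1.
pose D (_ _ : 'I_1) : {set {ffun 'I_n -> avY A}} := [set: _]%SET.
have Ddisj g k k' : k != k' -> [disjoint D g k & D g k'] by rewrite !ord1.
pose c : Defs.code A n := @MkCode R A n 1 1 isT isT E Ech D Ddisj.
exists c; split=> //; apply/eqP; rewrite eq_le ?error_ge0 ?max_leakMI_ge0 andbT.
  apply: error_lub => // s; have [W0 W1] := nW_channel s.
  rewrite subr0 success_mean /= big_ord1 invr1 mul1r /gsucc /= big_ord1 invr1 mul1r.
  rewrite (sum_ind_eq (fun x => \sum_(y in [set: {ffun 'I_n -> avY A}]%SET) nW s x y) x0).
  rewrite -(W1 x0) le_eqVlt; apply/orP; left; apply/eqP.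
  by apply: eq_bigl => y; rewrite inE.
apply: max_leakMI_lub => // s; rewrite (leakMI_single s (ord0 : 'I_(cG c))) //.
apply: le_trans (gjoint_MI_le _ _) _.
by rewrite /log2 ln1 mul0r.
Qed.

Lemma C_S_lower (r : R) :
  (forall e, 0 < e -> exists N, forall n, (N <= n)%N -> exists c : Defs.code A n,
     [/\ cG c = 1%N, error c <= e, max_leakMI c <= e & r - e <= log2 (cK c)%:R / n%:R]) ->
  (r%:E <= C_S A)%E.
Proof.
move=> H.
have [c [cG1 cerr [r' rr' crate] clk]] := good_sequence
  (P := fun n c => cG c = 1%N) (lk := fun n c => max_leakMI c)
  (fun n c => max_leakMI_ge0 c)
  (fun n => let: ex_intro c (And4 _ G1 _ _) := trivial_code n in ex_intro _ c G1) H.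
apply: (@le_trans _ _ r'%:E); first by rewrite lee_fin.
by apply: ereal_sup_ubound; exists r' => //; exists c; split=> //.
Qed.

Lemma C_Sran_lower (r : R) :
  (forall e, 0 < e -> exists N, forall n, (N <= n)%N -> exists c : Defs.code A n,
     [/\ error c <= e, max_leakCMI c <= e & r - e <= log2 (cK c)%:R / n%:R]) ->
  (r%:E <= C_Sran_mean A)%E.
Proof.
move=> H.
have [c [_ cerr [r' rr' crate] clk]] := good_sequence
  (P := fun n c => True) (lk := fun n c => max_leakCMI c)
  (fun n c => max_leakCMI_ge0 c)
  (fun n => let: ex_intro c _ := trivial_code n in ex_intro _ c I)
  (fun e e0 => let: ex_intro N HN := H e e0 in ex_intro _ N (fun n Nn =>
     let: ex_intro c (And3 h1 h2 h3) := HN n Nn in ex_intro _ c (And4 I h1 h2 h3))).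
apply: (@le_trans _ _ r'%:E); first by rewrite lee_fin.
by apply: ereal_sup_ubound; exists r' => //; exists c; split=> //.
Qed.

Lemma C_S_ge0 : (0 <= C_S A)%E.
Proof.
apply: C_S_lower => e e0; exists 0%N => n _; have [c [K1 G1 err lkc]] := trivial_code n.
by exists c; rewrite err lkc K1 /log2 ln1 !mul0r sub0r oppr_le0 ltW.
Qed.

Lemma C_S_le_C_Sran : (C_S A <= C_Sran_mean A)%E.
Proof.
apply: le_ereal_sup => _ [r [c [G1 [cerr [crate clk]]]] <-]; exists r => //.
exists c; do 2 split=> //; rewrite -[RHS]clk; congr limn_esup.
by apply/funext => n; rewrite max_leakCMI_single.
Qed.

End Capacities.

(** * Removing common randomness over a nonsymmetrizable channel *)

Section Derandomization.
Variables (R : realType) (A : AVWC R).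

(** A bound on the rate of codes with error at most 1/2; leakages divided by [n * b] lie in the unit
    interval, as sampling requires. *)
Let b : R := 1 + log2 (#|avY A|.+1)%:R.

Let b_ge1 : 1 <= b.
Proof. by rewrite lerDl log2_ge0 // ler1n. Qed.

Let b_gt0 : 0 < b.
Proof. exact: lt_le_trans b_ge1. Qed.

(** Sampling handles error and leakage at once: each state sequence gives one constraint on the
    failure probability and one on the normalized leakage, [2 * #|avS A| ^ n] in all. The factors 2
    come from the Chernoff bound. *)
Lemma derandomize (m n L : nat) (c : Defs.code A n) (ep e : R) :
  (0 < L)%N -> (0 < n)%N -> error c <= 1 / 2 -> 0 <= ep -> 0 <= e ->
  prefix_code A m L ep ->
  (2 * #|avS A| ^ n)%:R * expR (- (L%:R * e / 2)) < 1 ->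
  exists c' : Defs.code A (m + n),
    [/\ cG c' = 1%N, cK c' = cK c, error c' <= ep + 2 * error c + e &
        max_leakMI c' <= 2 * max_leakCMI c + n%:R * b * e].
Proof.
move=> L0 n0 err ep0 e0 [M [xp [Dp [ML disj suc]]]] Llarge.
have M0 : (0 < #|M|)%N by rewrite ML.
have nb0 : 0 < n%:R * b by rewrite mulr_gt0 // ltr0n.
pose J := ({ffun 'I_n -> avS A} + {ffun 'I_n -> avS A})%type.
pose f (j : J) (g : 'I_(cG c)) : R := match j with
  | inl s => 1 - gsucc s g | inr s => MI (gjoint s g) / (n%:R * b) end.
pose mu (j : J) : R := match j with
  | inl _ => error c | inr _ => max_leakCMI c / (n%:R * b) end.
have f01 j g : 0 <= f j g <= 1.
  case: j => s /=.
    by have := gsucc_ge0 s g; have := gsucc_le1 s g => *; apply/andP; split; lra.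
  apply/andP; split; first by rewrite divr_ge0 ?gjoint_MI_ge0 // ltW.
  rewrite ler_pdivrMr // mul1r; apply: le_trans (gjoint_MI_le _ _) _.
  exact: log2_code_size.
have fmean j : #|{: 'I_(cG c)}|%:R^-1 * \sum_g f j g <= mu j.
  rewrite card_ord; case: j => s /=.
    apply: le_trans (error_ub c s); rewrite sumrB sumr_const card_ord mulrBr.
    by rewrite mulVf ?gt_eqF ?cG_gt0R // -success_mean.
  by rewrite -mulr_suml mulrA ler_pM2r ?invr_gt0 // -leakCMI_mean leakCMI_ub.
have J_card : #|{: J}| = (2 * #|avS A| ^ n)%N.
  by rewrite card_sum card_ffun card_ord addnn -mul2n.
have [gam gamP] := @sampling R J 'I_(cG c) M f mu e
   (eq_ind_r (fun k => (0 < k)%N) (cG_gt0 c) (card_ord _)) M0 f01 fmean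
   (eq_ind_r (fun k => k%:R * expR (- (#|M|%:R * e / 2)) < 1)
      (eq_ind_r (fun k => _%:R * expR (- (k%:R * e / 2)) < 1) Llarge ML) J_card).
exists (elim_code xp gam M0 disj); split=> //.
- apply: error_lub => [|s]; first by have := error_ge0 c; lra.
  apply: le_trans (elim_success xp gam M0 disj s).
  have := suc (lhalf s); have := gamP (inl (rhalf s)); rewrite /= ML.
  rewrite sumrB sumr_const mulrBr ML mulVf ?pnatr_eq0 -?lt0n //.
  by move: (_ * _) (_ * _) => u v; lra.
- have lk0 := max_leakCMI_ge0 c.
  apply: max_leakMI_lub => [|s]; first by rewrite addr_ge0 ?mulr_ge0 // ltW.
  apply: le_trans (elim_leak xp gam M0 disj s) _.
  have := gamP (inr (rhalf s)); rewrite /= -mulr_suml [leLHS]mulrA ler_pdivrMr //.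
  move=> h; apply: le_trans h _; rewrite mulrDl -[2 * _ * _]mulrA divfK ?gt_eqF //.
  by rewrite [e * _]mulrC.
Qed.

Lemma nonsym_C_S_ge (r : R) : ~ symmetrizable A -> achievable_Sran A r ->
  (r%:E <= C_S A)%E.
Proof.
move=> nsym [c [cerr [crate clk]]]; apply: C_S_lower => e e0.
have r0 : 0 <= r.
  rewrite -lee_fin -crate; apply: limn_einf_ge => d d0; exists 0%N => n _.
  rewrite sub0r; apply: (@le_trans _ _ 0); first by rewrite oppr_le0 ltW.
  by rewrite divr_ge0 ?log2_cK_ge0.
(* The bound 1/2 gives access to the code size estimate; [4 * e1 * (1 + r) <= e] absorbs the sum of
   all errors and the rate loss [e1 + e1 * r]. *)
pose e1 := Num.min (1 / 2) (e / (4 * (1 + r))).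
have e10 : 0 < e1 by rewrite lt_min divr_gt0 //= divr_gt0 //; lra.
have e1h : e1 <= 1 / 2 by rewrite ge_min lexx.
have e1e : 4 * e1 * (1 + r) <= e.
  have : e1 <= e / (4 * (1 + r)) by rewrite ge_min lexx orbT.
  by rewrite ler_pdivlMr ?mulr_gt0 //; lra.
clearbody e1.
have er : 0 <= e1 * r by rewrite mulr_ge0 // ltW.
have ee : 0 <= e1 * e1 by rewrite mulr_ge0 // ltW.
have [Na Ha] := (cvg0_eventually (fun n => error_ge0 (c n))).1 cerr e1 e10.
have [Nb Hb] := limn_esup_0_eventually (fun n => max_leakCMI_ge0 (c n)) clk e10.
have [Nc Hc] := limn_einf_eventually crate e10.
have [Nd Hd] := nonsym_prefix_codes nsym e10.
pose N1 := maxn Na (maxn Nb Nc).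
pose N2 := maxn (maxn (2 * N1.+1) (4 * #|avS A|.+1)) (maxn (Num.bound (b / e1)).+1 Nd).
exists N2 => N; rewrite !geq_max => /andP[/andP[NN1 NS] /andP[Nb1 NNd]].
have [m [L [pc mN LN]]] := Hd N NNd.
have N0 : (0 < N)%N by apply: leq_trans NN1; rewrite muln_gt0.
have N0' : 0 < N%:R :> R by rewrite ltr0n.
(* The prefix takes at most half of the letters, so the remaining length [n] still exceeds all
   thresholds of the given code sequence. *)
have mN' : (2 * m <= N)%N.
  rewrite -(ler_nat R) natrM; apply: (@le_trans _ _ (2 * (e1 * N%:R))).
    by rewrite ler_pM2l.
  by rewrite mulrA -[leRHS]mul1r ler_pM2r //; lra.
have mleN : (m <= N)%N by move: mN'; clear; lia.
have [n NE] : exists n, N = (m + n)%N by exists (N - m)%N; rewrite subnKC.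
have nN1 : (N1 < n)%N by move: NN1 mN'; rewrite NE; clear; lia.
have n0 : (0 < n)%N := leq_ltn_trans (leq0n _) nN1.
have [Nan Nbn Ncn] : [/\ (Na <= n)%N, (Nb <= n)%N & (Nc <= n)%N].
  by move: nN1; rewrite !gtn_max => /and3P[/ltnW ? /ltnW ? /ltnW ?].
have L0 : (0 < L)%N by apply: leq_trans LN; rewrite expn_gt0 N0.
(* With [L >= N ^ 4] the exponent [L * eps] is at least [N ^ 2], which beats the exponentially many
   constraints, while [n * b * eps] is of order [1 / N]. *)
pose eps : R := N%:R ^- 2.
have eps0 : 0 <= eps by rewrite invr_ge0 exprn_ge0.
have bN : b <= e1 * N%:R.
  rewrite -ler_pdivrMl // mulrC; apply: (le_trans (ltW (archi_boundP _))).
    by rewrite divr_ge0 // ltW.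
  by rewrite ler_nat ltnW.
have epsN : N%:R * eps = N%:R^-1 by rewrite /eps; field; rewrite gt_eqF.
have bE : n%:R * b * eps <= e1.
  apply: (@le_trans _ _ (N%:R * b * eps)).
    by rewrite ler_wpM2r // ler_pM2r // ler_nat NE leq_addl.
  by rewrite mulrAC epsN mulrC ler_pdivrMr.
have epsE : eps <= e1.
  apply: le_trans bE; rewrite -[leLHS]mul1r ler_wpM2r //.
  by rewrite -[leLHS]mulr1; apply: ler_pM => //; rewrite ler1n.
have large : (2 * #|avS A| ^ n)%:R * expR (- (L%:R * eps / 2)) < 1.
  rewrite expRN ltr_pdivrMr ?expR_gt0 // mul1r.
  have SN : (2 * #|avS A|.+1)%:R < expR (N%:R / 2) :> R.
    apply: lt_le_trans (expR_ge1Dx _).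
    have : (4 * #|avS A|.+1)%:R <= N%:R :> R by rewrite ler_nat.
    by rewrite !natrM; lra.
  apply: (@le_lt_trans _ _ ((2 * #|avS A|.+1)%:R ^+ N)).
    rewrite -natrX ler_nat expnMn; apply: leq_mul.
      by rewrite -{1}(expn1 2) leq_exp2l.
    apply: (@leq_trans (#|avS A|.+1 ^ n)); first by rewrite leq_exp2r.
    by rewrite leq_pexp2l // NE leq_addl.
  apply: (@lt_le_trans _ _ (expR (N%:R / 2) ^+ N)); first by rewrite ltrXn2r // -?lt0n // ltW.
  rewrite -expRM_natl ler_expR mulrA ler_pM2r //.
  rewrite /eps ler_pdivlMr ?exprn_gt0 // -!natrM -natrX -natrM ler_nat.
  by rewrite mulnn -expnD.
have [c' [G1 K1 err' lk']] := derandomize L0 n0 (le_trans (Ha n Nan) e1h) (ltW e10) eps0 pc large.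
have rate' : r - e <= log2 (cK c')%:R / (m + n)%:R.
  rewrite K1 -NE; have lK := log2_cK_ge0 (c n).
  have [re|re] := leP (r - e1) 0.
    by apply: (@le_trans _ _ 0); [lra|rewrite divr_ge0].
  have := Hc n Ncn; rewrite ler_pdivlMr ?ltr0n // => hK.
  rewrite ler_pdivlMr //; apply: le_trans hK.
  have nN : (1 - e1) * N%:R <= n%:R.
    by move: mN; rewrite NE natrD; lra.
  apply: (@le_trans _ _ ((r - e1) * ((1 - e1) * N%:R))); last by rewrite ler_pM2l.
  by rewrite mulrA ler_pM2r //; lra.
have errn := Ha n Nan; have lkn := Hb n Nbn.
rewrite NE; exists c'; split=> //.
- by apply: le_trans err' _; lra.
- by apply: le_trans lk' _; lra.
Qed.

Lemma nonsym_C_S : ~ symmetrizable A -> C_S A = C_Sran_mean A.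
Proof.
move=> nsym; apply/eqP; rewrite eq_le C_S_le_C_Sran /=.
by apply: ub_ereal_sup => _ [r rach <-]; exact: nonsym_C_S_ge.
Qed.

End Derandomization.

(** * The symmetrizing attack on codes without common randomness *)

Section SymmetrizingAttack.
Variables (R : realType) (A : AVWC R) (U : avX A -> avS A -> R).
Hypothesis U_ch : is_channel U.
Hypothesis U_sym : forall (x x' : avX A) (y : avY A),
  \sum_s U x s * avW s x' y = \sum_s U x' s * avW s x y.

Variables (n : nat) (c : Defs.code A n) (g : 'I_(cG c)).
Hypothesis G1 : cG c = 1%N.
Notation K := (cK c).

Let nU (x : {ffun 'I_n -> avX A}) (s : {ffun 'I_n -> avS A}) : R :=
  \prod_i U (x i) (s i).

Let nU_ch : is_channel nU.
Proof.
split=> [x s|x]; first by apply: prodr_ge0 => i _; case: U_ch.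
by apply: (sum_prod_channel (w := fun i => U (x i))) => i; case: U_ch.
Qed.

Let T x x' y := \sum_s nU x s * nW s x' y.

Let T_sym x x' y : T x x' y = T x' x y.
Proof.
have TE u v : T u v y = \prod_i \sum_sg U (u i) sg * avW sg (v i) (y i).
  rewrite bigA_distr_bigA; apply: eq_bigr => s _; rewrite -big_split /=.
  by [].
by rewrite !TE; apply: eq_bigr => i _; exact: U_sym.
Qed.

Let T_ge0 x x' y : 0 <= T x x' y.
Proof.
apply: sumr_ge0 => s _; have [W0 _] := nW_channel s; have [U0 _] := nU_ch.
by rewrite mulr_ge0.
Qed.

Let T_sum x x' : \sum_y T x x' y = 1.
Proof.
have [_ /(_ x) <-] := nU_ch; rewrite exchange_big /=; apply: eq_bigr => s _.
by have [_ W1] := nW_channel s; rewrite -mulr_sumr W1 mulr1.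
Qed.

(* The output law when [k] is sent and the adversary simulates the message [k']. *)
Let Q (k k' : 'I_K) (y : {ffun 'I_n -> avY A}) : R :=
  \sum_x \sum_x' cE g k x * cE g k' x' * T x' x y.

Let Q_sym k k' y : Q k k' y = Q k' k y.
Proof.
rewrite /Q exchange_big; apply: eq_bigr => x _; apply: eq_bigr => x' _.
by rewrite [cE g k _ * _]mulrC T_sym.
Qed.

Let Q_ge0 k k' y : 0 <= Q k k' y.
Proof.
have [E0 _] := cE_ch g.
by apply: sumr_ge0 => x _; apply: sumr_ge0 => x' _; rewrite !mulr_ge0.
Qed.

Let Q_sum k k' : \sum_y Q k k' y = 1.
Proof.
have [_ E1] := cE_ch g.
rewrite exchange_big /= -(E1 k); apply: eq_bigr => x _.
rewrite exchange_big /= -[RHS]mulr1 -(E1 k') mulr_sumr; apply: eq_bigr => x' _.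
by rewrite -mulr_sumr T_sum mulr1.
Qed.

(** By [Q_sym] this concerns a single output law and two decoding sets, which are disjoint when [k]
    and [k'] differ. *)
Let QD k k' : \sum_(y in cD g k) Q k k' y + \sum_(y in cD g k') Q k k' y <= 1 + (k == k')%:R.
Proof.
have [<-|kk'] := eqVneq k k'.
  by apply: lerD; apply: sum_set_le1.
rewrite addr0 -bigU /=; last exact: cD_disj.
rewrite (eq_bigl (fun y => y \in (cD g k :|: cD g k')%SET)); last by move=> y; rewrite !inE.
exact: sum_set_le1.
Qed.

Let total_le : \sum_k \sum_k' \sum_(y in cD g k) Q k k' y <= (K%:R * K%:R + K%:R) / 2.
Proof.
rewrite ler_pdivlMr // [leLHS]mulr_natr mulr2n.
rewrite [X in _ + X <= _]exchange_big /= -big_split /=.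
apply: (@le_trans _ _ (\sum_(k < K) \sum_(k' < K) (1 + (k' == k)%:R))).
  apply: ler_sum => k _; rewrite -big_split /=; apply: ler_sum => k' _.
  rewrite eq_sym; apply: le_trans (QD k k'); rewrite lerD2l.
  by under eq_bigr do rewrite Q_sym.
under eq_bigr => k _.
  rewrite big_split /= sumr_const card_ord.
  rewrite (eq_bigr (fun k' => (k' == k)%:R * 1)); last by move=> k' _; rewrite mulr1.
  rewrite (sum_ind_eq (fun=> 1)); over.
by rewrite sumr_const card_ord -[leLHS]mulr_natl mulrDr mulr1.
Qed.

(** The attack is a mixture of state sequences, each of which leaves success probability at least
    [1 - error c]. *)
Let total_ge : K%:R * K%:R * (1 - error c) <= \sum_k \sum_k' \sum_(y in cD g k) Q k k' y.
Proof.
have [E0 E1] := cE_ch g; have [U0 U1] := nU_ch.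
have K0 := cK_gt0R c.
have gE s : gsucc s g = success c s.
  rewrite success_mean; have -> : (cG c)%:R = 1 :> R by rewrite G1.
  rewrite invr1 mul1r (big_pred1 g) // => g' /=.
  by rewrite (ord_eq1 g' g G1) eqxx.
have -> : \sum_k \sum_k' \sum_(y in cD g k) Q k k' y =
    \sum_k' \sum_x' cE g k' x' * \sum_s nU x' s * (K%:R * success c s).
  rewrite exchange_big /=; apply: eq_bigr => k' _.
  have -> : \sum_(k < K) \sum_(y in cD g k) Q k k' y =
     \sum_(k < K) \sum_x \sum_x' \sum_s cE g k' x' * (nU x' s * (cE g k x *
       \sum_(y in cD g k) nW s x y)).
    apply: eq_bigr => k _; rewrite exchange_big /=; apply: eq_bigr => x _.
    rewrite exchange_big /=; apply: eq_bigr => x' _.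
    under eq_bigr => y _ do rewrite mulr_sumr.
    rewrite exchange_big /=; apply: eq_bigr => s _.
    by rewrite !mulr_sumr; apply: eq_bigr => y _; ring.
  under [LHS]eq_bigr => k _ do rewrite exchange_big /=.
  rewrite exchange_big /=; apply: eq_bigr => x' _.
  under [LHS]eq_bigr => k _ do rewrite exchange_big /=.
  rewrite exchange_big /= mulr_sumr; apply: eq_bigr => s _.
  rewrite -gE /gsucc mulVKf ?gt_eqF // !mulr_sumr; apply: eq_bigr => k _.
  by rewrite !mulr_sumr.
apply: (@le_trans _ _ (\sum_(k' < K) K%:R * (1 - error c))).
  by rewrite sumr_const card_ord -[leRHS]mulr_natl mulrA.
apply: ler_sum => k' _; rewrite -[leLHS]mul1r -[X in X * _ <= _](E1 k') mulr_suml.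
apply: ler_sum => x' _; apply: ler_wpM2l => //.
rewrite -[leLHS]mul1r -[X in X * _ <= _](U1 x') mulr_suml; apply: ler_sum => s _.
apply: ler_wpM2l => //; rewrite ler_pM2l //.
by have := error_ub c s; lra.
Qed.

(** Comparing both bounds gives [1 - error c <= 1 / 2 + 1 / (2 * K)], which is at most 3/4 for two
    or more messages. *)
Lemma sym_error : (1 < K)%N -> 1 / 4 <= error c.
Proof.
move=> K2; have := le_trans total_ge total_le.
have : 2 <= K%:R :> R by rewrite ler_nat.
move: (K%:R) (error c) => k e; rewrite leNgt => kk k2; apply/negP => e4.
have kk0 : 0 < k * k * (1 / 4 - e) by rewrite !mulr_gt0 //; lra.
have : 0 <= k * (k - 2) by rewrite mulr_ge0 //; lra.
by lra.
Qed.

End SymmetrizingAttack.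

Lemma sym_C_S (R : realType) (A : AVWC R) : symmetrizable A -> C_S A = 0%E.
Proof.
move=> [U [U_ch U_sym]]; apply/eqP; rewrite eq_le C_S_ge0 andbT.
apply: ub_ereal_sup => _ [r [c [G1 [cerr [crate _]]]] <-]; rewrite -crate.
apply: limn_einf_le.
(* Any threshold below 1/4 would do: from then on the codes have a single message and rate 0. *)
have e0 : 0 < 1 / 5 :> R by lra.
have [N HN] := (cvg0_eventually (fun n => error_ge0 (c n))).1 cerr _ e0.
exists N => n /HN err.
have g : 'I_(cG (c n)) by rewrite G1; exact: ord0.
have : (cK (c n) <= 1)%N.
  rewrite leqNgt; apply/negP => K2.
  by have := sym_error U_ch U_sym g (G1 n) K2; lra.
have := cK_gt0 (c n); case: (cK (c n)) => [|[|]] // _ _.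
by rewrite /log2 ln1 !mul0r.
Qed.

(** * Products and an example of super-activation *)

Section Product.
Variable R : realType.

(** Forwards, freeze the other input at its default letter, marginalize the other state and sum over
    the other output. Backwards, the product of the two symmetrizing channels works. *)
Lemma prod_symmetrizable (A1 A2 : AVWC R) :
  symmetrizable (avwc_prod A1 A2) <-> symmetrizable A1 /\ symmetrizable A2.
Proof.
split=> [[U [[U0 U1] Usym]]|[[U [[U0 U1] Usym]] [V [[V0 V1] Vsym]]]].
  split.
    exists (fun x s1 => \sum_s2 U (x, avX_inh A2) (s1, s2)); split.
      split=> [x s|x]; first by apply: sumr_ge0 => s2 _; exact: U0.
      rewrite pair_bigA /= -(U1 (x, avX_inh A2)).
      by apply: eq_bigr => -[].
    have E x x' y : \sum_s1 (\sum_s2 U (x, avX_inh A2) (s1, s2)) * avW s1 x' y =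
        \sum_y2 \sum_s U (x, avX_inh A2) s *
          avW (a := avwc_prod A1 A2) s (x', avX_inh A2) (y, y2).
      rewrite exchange_big /=; under [RHS]eq_bigr do rewrite -mulr_sumr -mulr_sumr.
      under [LHS]eq_bigr do rewrite mulr_suml.
      rewrite pair_bigA /=; apply: eq_bigr => -[s1 s2] _ /=.
      by have [_ ->] := avW_ch s2; rewrite mulr1.
    by move=> x x' y; rewrite !E; apply: eq_bigr => y2 _; exact: Usym.
  exists (fun x s2 => \sum_s1 U (avX_inh A1, x) (s1, s2)); split.
    split=> [x s|x]; first by apply: sumr_ge0 => s1 _; exact: U0.
    rewrite exchange_big pair_bigA /= -(U1 (avX_inh A1, x)).
    by apply: eq_bigr => -[].
  have E x x' y : \sum_s2 (\sum_s1 U (avX_inh A1, x) (s1, s2)) * avW s2 x' y =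
      \sum_y1 \sum_s U (avX_inh A1, x) s *
        avW (a := avwc_prod A1 A2) s (avX_inh A1, x') (y1, y).
    rewrite exchange_big /=; under [RHS]eq_bigr do rewrite -mulr_sumr -mulr_suml.
    under [LHS]eq_bigr do rewrite mulr_suml.
    rewrite exchange_big pair_bigA /=; apply: eq_bigr => -[s1 s2] _ /=.
    by have [_ ->] := avW_ch s1; rewrite mul1r.
  by move=> x x' y; rewrite !E; apply: eq_bigr => y2 _; exact: Usym.
exists (fun x s => U x.1 s.1 * V x.2 s.2); split; first exact: prod_channel.
have E (x x' : avX A1 * avX A2) (y : avY A1 * avY A2) :
    \sum_(s : avS A1 * avS A2) U x.1 s.1 * V x.2 s.2 *
       (avW s.1 x'.1 y.1 * avW s.2 x'.2 y.2) =
    (\sum_s U x.1 s * avW s x'.1 y.1) * (\sum_s V x.2 s * avW s x'.2 y.2).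
  rewrite big_distrlr pair_bigA /=; apply: eq_bigr => -[s1 s2] _ /=; ring.
by move=> x x' y; rewrite !E Usym Vsym.
Qed.

End Product.

(** * Super-activation by a public bit and an adder channel *)

Section Example.
Variable R : realType.

Lemma deterministic_channel (T1 T2 : finType) (f : T1 -> T2) :
  is_channel (fun a b => (b == f a)%:R : R).
Proof.
split=> [a b|a]; first exact: boolr_ge0.
rewrite -[RHS](sum_ind_eq (fun=> 1 : R) (f a)).
by apply: eq_bigr => b _; rewrite mulr1.
Qed.

(* Noiseless to Bob, hence nonsymmetrizable, but Eve reads everything. *)
Definition public_bit : AVWC R :=
  @MkAVWC R bool bool bool unit true tt (fun _ x y => (y == x)%:R) (fun _ x z => (z == x)%:R)
    (fun _ => deterministic_channel id) (fun _ => deterministic_channel id).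

Definition adder (s x : bool) : option bool := if s == x then Some x else None.

(* Bob receives [x + s], with [None] for the ambiguous sum; Eve is blind. *)
Definition adder_channel : AVWC R :=
  @MkAVWC R bool (option bool) unit bool true true
    (fun s x y => (y == adder s x)%:R) (fun _ _ z => (z == tt)%:R)
    (fun s => deterministic_channel (adder s)) (fun _ => deterministic_channel (fun=> tt)).

(** The output is symmetric in state and input, so the identity channel symmetrizes. *)
Lemma adder_symmetrizable : symmetrizable adder_channel.
Proof.
exists (fun x s => (s == x)%:R); split; first exact: (deterministic_channel id).
move=> x x' y /=.
rewrite (sum_ind_eq (fun s => (y == adder s x')%:R)) (sum_ind_eq (fun s => (y == adder s x)%:R)).
by case: x; case: x'.
Qed.

Lemma public_bit_nonsymmetrizable : ~ symmetrizable public_bit.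
Proof.
move=> [U [[_ U1] /(_ true false true)]] /=.
rewrite -!mulr_suml !U1 !mul1r => /eqP.
by rewrite eq_sym oner_eq0.
Qed.

(** A weak Fano inequality. The test function is 3/2 on the decoding sets and 1/2 off them; under
    the product of the marginals decoding succeeds with probability at most [1 / #|TA| <= 1 / 2], so
    its mean there is at most 1. *)
Lemma MI_decodable (TA TB : finType) (P : TA -> TB -> R) (D : TA -> {set TB}) :
  (1 < #|TA|)%N -> (forall a b, 0 <= P a b) ->
  (forall a, \sum_b P a b = #|TA|%:R^-1) ->
  (forall a a', a != a' -> [disjoint D a & D a']) ->
  (\sum_a \sum_(b in D a) P a b) * ln (3 / 2)
    - (1 - \sum_a \sum_(b in D a) P a b) * ln 2 <= MI P * ln 2.
Proof.
move=> T2 P0 PA Ddisj; set p := \sum_a _.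
have T0 : 0 < #|TA|%:R :> R by rewrite ltr0n ltnW.
have P1 : \sum_a \sum_b P a b = 1.
  under eq_bigr do rewrite PA.
  by rewrite sumr_const -[LHS]mulr_natr mulVf // gt_eqF.
pose c a b : R := if b \in D a then 3 / 2 else 1 / 2.
have c0 a b : 0 < c a b by rewrite /c; case: ifP => _; lra.
apply: le_trans (MI_tangent P0 c0).
have q0 b : 0 <= \sum_a P a b by exact: sumr_ge0.
have -> : \sum_a \sum_b (P a b * ln (c a b) + P a b
    - c a b * ((\sum_b' P a b') * (\sum_a' P a' b))) =
  (p * ln (3 / 2) - (1 - p) * ln 2) + (1 / 2
    - \sum_a \sum_(b in D a) #|TA|%:R^-1 * \sum_a' P a' b).
  pose q (a : TA) b := #|TA|%:R^-1 * \sum_a' P a' b.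
  rewrite (eq_bigr (fun a => \sum_b ((if b \in D a then P a b else 0) * (ln (3 / 2) + ln 2)
     + P a b * (1 - ln 2) - q a b * (1 / 2) - (if b \in D a then q a b else 0)))); last first.
    move=> a _; apply: eq_bigr => b _; rewrite PA -/(q a b) /c.
    have l12 : ln (1 / 2) = - ln 2 :> R by rewrite div1r lnV // posrE.
    by case: ifP => _; rewrite ?l12; lra.
  under eq_bigr do rewrite !sumrB big_split /= -!mulr_suml -big_mkcond -big_mkcond.
  rewrite !sumrB big_split /= -!mulr_suml P1 -/p.
  have -> : \sum_a \sum_b q a b = 1.
    rewrite exchange_big /= /q.
    under eq_bigr do rewrite sumr_const -[_ *+ _]mulr_natl mulVKf ?gt_eqF //.
    by rewrite exchange_big.
  by lra.
rewrite lerDl subr_ge0.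
apply: (@le_trans _ _ (#|TA|%:R^-1 * \sum_b \sum_a' P a' b)).
  rewrite mulr_sumr (exchange_big_dep xpredT) //=; apply: ler_sum => b _.
  have [[a ba]|na] := pselect (exists a, b \in D a).
    rewrite (big_pred1 a) // => a' /=; apply/idP/eqP => [ba'|->//].
    apply/eqP; apply: contraT => aa'; have := disjointFr (Ddisj _ _ aa') ba'.
    by rewrite ba.
  rewrite big_pred0; first by rewrite mulr_ge0 // invr_ge0 ltW.
  by move=> a; apply/negbTE/negP => ba; apply: na; exists a.
rewrite exchange_big /= P1 mulr1 div1r lef_pV2 ?posrE //.
by rewrite ler_nat.
Qed.

(** Eve sees what Bob sees, so his decoding sets work for her: with two or more messages small error
    forces leakage bounded away from 0. *)
Lemma public_bit_C_S : C_S public_bit = 0%E.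
Proof.
apply/eqP; rewrite eq_le C_S_ge0 andbT.
apply: ub_ereal_sup => _ [r [c [G1 [cerr [crate clk]]]] <-]; rewrite -crate.
apply: limn_einf_le.
set l := ln (3 / 2 : R); have l0 : 0 < l by apply: ln_gt0; lra.
have l20 := ln2_gt0 R; set l2 := ln (2 : R) in l20.
(* Error and leakage at most [d] would give [l <= d * (l + 2 * l2)], whereas the right side equals
   [l / 2]. *)
pose d := l / (2 * (l + 2 * l2)).
have s0 : 0 < 2 * (l + 2 * l2) :> R by lra.
have dE : d * (2 * (l + 2 * l2)) = l by rewrite /d divfK // gt_eqF.
have d0 : 0 < d by rewrite divr_gt0.
clearbody d.
have [N HN] := (cvg0_eventually (fun n => error_ge0 (c n))).1 cerr d d0.
have [N' HN'] := limn_esup_0_eventually (fun n => max_leakMI_ge0 (c n)) clk d0.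
exists (maxn N N') => n; rewrite geq_max => /andP[/HN err /HN' lk].
have g : 'I_(cG (c n)) by rewrite G1; exact: ord0.
have : (cK (c n) <= 1)%N.
  rewrite leqNgt; apply/negP => K2.
  pose s : {ffun 'I_n -> avS public_bit} := [ffun=> tt].
  have := @MI_decodable _ _ (gjoint s g) (cD g).
  rewrite card_ord => /(_ K2 (gjoint_ge0 s g) (gjoint_marg s g) (cD_disj g)).
  have -> : \sum_a \sum_(b in cD g a) gjoint s g a b = success (c n) s.
    rewrite success_mean; have -> : (cG (c n))%:R = 1 :> R by rewrite G1.
    rewrite invr1 mul1r (big_pred1 g); last first.
      by move=> g' /=; rewrite (ord_eq1 g' g (G1 n)) eqxx.
    rewrite /gsucc mulr_sumr; apply: eq_bigr => k _; rewrite -mulr_sumr.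
    congr (_ * _); rewrite exchange_big /=; apply: eq_bigr => x _.
    by rewrite mulr_sumr.
  rewrite -(leakMI_single s g) // -/l -/l2.
  have := leakMI_ub (c n) s; have := error_ub (c n) s.
  move: (success _ _) (leakMI _ _) => p i h1 h2 h3.
  have hp : 1 - d <= p by lra.
  have hi : i <= d by lra.
  have : (1 - d) * l <= p * l by rewrite ler_pM2r.
  have : (1 - p) * l2 <= d * l2 by rewrite ler_pM2r //; lra.
  have : i * l2 <= d * l2 by rewrite ler_pM2r.
  by lra.
have := cK_gt0 (c n); case: (cK (c n)) => [|[|]] // _ _.
by rewrite /log2 ln1 !mul0r.
Qed.

Lemma MI_independent (TA TB : finType) (p : TB -> R) (k : R) :
  #|TA|%:R * k = 1 -> \sum_b p b = 1 ->
  MI (fun (_ : TA) b => k * p b) = 0.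
Proof.
move=> k1 p1; rewrite /MI big1 // => a _; rewrite big1 // => b _.
rewrite -mulr_sumr p1 mulr1 sumr_const -[X in _ / (_ * X)]mulr_natl mulrA k1 mul1r.
have [->|pn] := eqVneq (p b) 0; first by rewrite mulr0 mul0r.
have kn : k != 0 by apply: contraTneq isT => k0; move/eqP: k1; rewrite k0 mulr0 eq_sym oner_eq0.
by rewrite divff ?mulf_neq0 // /log2 ln1 mul0r mulr0.
Qed.

Section RandomCode.
Variables (n K : nat).
Hypothesis K_gt0 : (0 < K)%N.
Notation A := (avwc_prod public_bit adder_channel).
(** Codebooks, listed time by time with the letters of all messages. The common randomness is a
    uniform choice among all of them. *)
Notation B := {ffun 'I_n -> {ffun 'I_K -> bool}}.
Notation X := {ffun 'I_n -> avX A}.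
Notation Y := {ffun 'I_n -> avY A}.
Notation G := #|{: B}|.

Let G_gt0 : (0 < G)%N.
Proof. by apply/card_gt0P; exists [ffun=> [ffun=> true]]. Qed.

(** The public bit is held constant, so that Eve's output carries no information on the message. *)
Let word (f : B) (k : 'I_K) : X := [ffun i => (true, f i k)].
Let output (s : {ffun 'I_n -> avS A}) (x : X) : Y :=
  [ffun i => ((x i).1, adder (s i).2 (x i).2)].
Let fits (f : B) (k : 'I_K) (y : Y) : bool :=
  [forall i, ((y i).2 == None) || ((y i).2 == Some (f i k))].

Let E (g : 'I_G) (k : 'I_K) (x : X) : R := (x == word (enum_val g) k)%:R.
Let D (g : 'I_G) (k : 'I_K) : {set Y} :=
  [set y | fits (enum_val g) k y && [forall k', (k' != k) ==> ~~ fits (enum_val g) k' y]]%SET.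

Let E_ch g : is_channel (E g).
Proof. exact: (deterministic_channel (word (enum_val g))). Qed.

Let D_disj g k k' : k != k' -> [disjoint D g k & D g k'].
Proof.
move=> kk'; rewrite -setI_eq0; apply/eqP/setP => y; rewrite !inE.
apply/negbTE/negP => /andP[/andP[_ /forallP/(_ k')]]; rewrite eq_sym kk' /= => nf.
by rewrite (negbTE nf).
Qed.

Let c : Defs.code A n := @MkCode R A n K G K_gt0 G_gt0 E E_ch D D_disj.

Let t (s a b : bool) : bool := (adder s a == None) || (adder s a == Some b).

Let fits_own f k s : fits f k (output s (word f k)).
Proof.
apply/forallP => i; rewrite !ffunE /= /adder.
by case: ((s i).2 == f i k); rewrite eqxx ?orbT.
Qed.

(** The sent word always fits the output, so decoding fails only if a competitor fits too. *)
Let prob_success s (g : 'I_G) k :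
  1 - \sum_(k' | k' != k) (fits (enum_val g) k' (output s (word (enum_val g) k)))%:R <=
  \sum_x cE (c := c) g k x * \sum_(y in cD (c := c) g k) nW s x y.
Proof.
set f := enum_val g; set o := output s (word f k).
rewrite /= /E (sum_ind_eq (fun x => \sum_(y in D g k) nW s x y) (word f k)).
have [W0 _] := nW_channel s.
have [[k' k'P]|nk] := pselect (exists k', (k' != k) && fits f k' o).
  case/andP: k'P => k'k fk'; apply: (@le_trans _ _ 0); last by apply: sumr_ge0.
  rewrite subr_le0 (bigD1 k') //= fk' lerDl.
  by apply: sumr_ge0 => j _; exact: boolr_ge0.
have oD : o \in D g k.
  rewrite inE fits_own /=; apply/forallP => k'; apply/implyP => k'k; apply/negP => fk'.
  by apply: nk; exists k'; rewrite k'k.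
rewrite (bigD1 o) //=.
have -> : nW s (word f k) o = 1.
  by rewrite /nW big1 // => i _; rewrite /= !ffunE /= !eqxx mulr1.
have h1 : 0 <= \sum_(k' | k' != k) (fits f k' o)%:R :> R.
  by apply: sumr_ge0 => j _; exact: boolr_ge0.
have h2 : 0 <= \sum_(y in D g k | y != o) nW s (word f k) y by apply: sumr_ge0.
by lra.
Qed.

Let sum_pair (h : bool -> bool -> R) (k k' : 'I_K) : k' != k ->
  \sum_(w : {ffun 'I_K -> bool}) h (w k) (w k') =
  2 ^+ K / 4 * \sum_a \sum_b h a b.
Proof.
move=> k'k; have b0 : (0 < #|{: bool}|)%N by rewrite card_bool.
rewrite (eq_bigr (fun w : {ffun 'I_K -> bool} =>
   \sum_b h (w k) b * (b == w k')%:R)); last first.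
  move=> w _; under eq_bigr do rewrite mulrC.
  by rewrite (sum_ind_eq (h (w k)) (w k')).
rewrite exchange_big /= [in RHS]exchange_big mulr_sumr /=; apply: eq_bigr => b _.
rewrite (@sum_ffun_coord_mean R _ _ k (h ^~ b)
  (fun w : {ffun 'I_K -> bool} => (b == w k')%:R)) //; last first.
  by move=> w w' ww'; rewrite ww'.
have -> : \sum_(w : {ffun 'I_K -> bool}) (b == w k')%:R = 2 ^+ K / 2 :> R.
  rewrite (eq_bigr (fun w : {ffun 'I_K -> bool} => (b == w k')%:R * 1)); last first.
    by move=> w _; rewrite mulr1.
  rewrite (@sum_ffun_coord_mean R _ _ k' (fun a => (b == a)%:R) (fun=> 1)) //.
  rewrite sumr_const card_ffun card_bool card_ord natrX.
  by rewrite big_bool; case: b => /=; field.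
by rewrite card_bool; field.
Qed.

(** Per letter a competitor fits with probability 3/4: the sum is ambiguous half of the time, and
    otherwise the two independent uniform letters agree half of the time. *)
Let prob_collision s k k' : k' != k ->
  \sum_(f : B) (fits f k' (output s (word f k)))%:R = (2 ^+ K) ^+ n * (3 / 4) ^+ n :> R.
Proof.
move=> k'k.
have -> : \sum_(f : B) (fits f k' (output s (word f k)))%:R =
    \sum_(f : B) \prod_i (t (s i).2 (f i k) (f i k'))%:R :> R.
  apply: eq_bigr => f _; rewrite /fits.
  have -> : [forall i, ((output s (word f k) i).2 == None)
      || ((output s (word f k) i).2 == Some (f i k'))] =
      [forall i, t (s i).2 (f i k) (f i k')].
    by apply: eq_forallb => i; rewrite !ffunE.
  case: (boolP [forall i, _]) => [/forallP all1|].
    by rewrite big1 // => i _; rewrite all1.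
  by rewrite negb_forall => /existsP[i /negbTE it]; rewrite (bigD1 i) //= it mul0r.
rewrite -(bigA_distr_bigA (fun i (w : {ffun 'I_K -> bool}) => (t (s i).2 (w k) (w k'))%:R)).
rewrite -exprMn -[X in _ ^+ X](card_ord n) -prodr_const; apply: eq_bigr => i _.
rewrite (sum_pair (fun a b => (t (s i).2 a b)%:R)) //.
by rewrite !big_bool /= /t /adder; case: (s i).2 => /=; field.
Qed.

Lemma random_code_error : error c <= K%:R * (3 / 4) ^+ n.
Proof.
have K0 : 0 < K%:R :> R by rewrite ltr0n.
have G0 : 0 < G%:R :> R by rewrite ltr0n.
have enumE (F : B -> R) : \sum_(i < G) F (enum_val i) = \sum_f F f.
  by rewrite [RHS](reindex _ (onW_bij _ (enum_val_bij B))).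
apply: error_lub => [|s]; first by rewrite mulr_ge0 ?exprn_ge0.
rewrite success_mean /= -(ler_pM2l G0) mulVKf ?gt_eqF //.
rewrite -(ler_pM2l K0) mulr_sumr.
under [leRHS]eq_bigr do rewrite mulVKf ?gt_eqF //.
apply: le_trans; last by apply: ler_sum => g _; apply: ler_sum => k _; exact: prob_success.
rewrite exchange_big /=.
apply: (@le_trans _ _ (\sum_(k < K) G%:R * (1 - K%:R * (3 / 4) ^+ n))).
  by rewrite sumr_const card_ord -[leRHS]mulr_natl.
apply: ler_sum => k _; rewrite sumrB sumr_const card_ord mulrBr mulr1 lerD2l lerN2.
rewrite exchange_big /=.
apply: (@le_trans _ _ (\sum_(k' | k' != k) G%:R * (3 / 4) ^+ n)).
  apply: ler_sum => k' k'k.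
  rewrite (enumE (fun f => (fits f k' (output s (word f k)))%:R)) prob_collision //.
  by rewrite !card_ffun card_bool !card_ord !natrX.
rewrite sumr_const -[leLHS]mulr_natl mulrCA ler_pM2l // ler_wpM2r ?exprn_ge0 //.
by rewrite ler_nat -[leqRHS](card_ord K) max_card.
Qed.

Lemma random_code_leak : max_leakCMI c <= 0.
Proof.
have K0 : 0 < K%:R :> R by rewrite ltr0n.
apply: max_leakCMI_lub => // s; rewrite leakCMI_mean big1 ?mulr0 // => g _.
pose x0 : X := [ffun=> (true, true)].
have [_ V1] := nV_channel s.
rewrite -(@MI_independent 'I_K _ (nV s x0) K%:R^-1) ?card_ord ?divff ?gt_eqF //.
apply: MI_eq => k z; rewrite /gjoint /= /E; congr (_ * _).
rewrite (sum_ind_eq (fun x => nV s x z)).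
by apply: eq_bigr => i _; rewrite /= !ffunE.
Qed.

Lemma random_code : exists c : Defs.code A n,
  [/\ cK c = K, error c <= K%:R * (3 / 4) ^+ n & max_leakCMI c <= 0].
Proof.
by exists c; split=> //; [exact: random_code_error|exact: random_code_leak].
Qed.

End RandomCode.

(** With [2 ^ j] messages and [j] the integer part of [n / 3], the error is at most [(27 / 32) ^ j].
    The rate is near 1/3; the value 1/6 absorbs the rounding, as [n < 3 * j + 3 <= 6 * j] once
    [j >= 1]. *)
Lemma example_C_Sran :
  ((1 / 6)%:E <= C_Sran_mean (avwc_prod public_bit adder_channel))%E.
Proof.
apply: C_Sran_lower => e e0.
have z1 : `|27 / 32 : R| < 1 by rewrite ger0_norm; lra.
have z0 n : 0 <= (27 / 32 : R) ^+ n by rewrite exprn_ge0.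
have [N HN] := (cvg0_eventually z0).1 (cvg_expr z1) e e0.
exists (3 * N + 6)%N => n Nn; pose j := (n %/ 3)%N.
have j3 : (3 * j <= n)%N by rewrite mulnC leq_trunc_div.
have nj : (n < 3 * j.+1)%N by rewrite mulnC ltn_ceil.
have Nj : (N <= j)%N by lia.
have K0 : (0 < 2 ^ j)%N by rewrite expn_gt0.
have [c [cKE err lk]] := random_code n K0; exists c; split.
- apply: le_trans err _; apply: le_trans (HN j Nj).
  have -> : (27 / 32 : R) ^+ j = (2 ^ j)%:R * (3 / 4) ^+ (3 * j).
    by rewrite natrX exprM -exprMn; congr (_ ^+ _); field.
  rewrite ler_pM2l ?ltr0n // ler_wiXn2l //; lra.
- by apply: le_trans lk _; exact: ltW.
have l2E : log2 ((2 : R) ^+ j) = j%:R.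
  by rewrite /log2 lnXn // -[_ *+ j]mulr_natr mulrAC divff ?mul1r // gt_eqF // ln2_gt0.
have n0 : (0 < n)%N by move: Nn; clear; lia.
have nR : n%:R <= 6 * j%:R :> R by rewrite -natrM ler_nat; move: nj Nn; clear; lia.
rewrite cKE natrX l2E ler_pdivlMr ?ltr0n // mulrBl.
have : 0 <= e * n%:R by rewrite mulr_ge0 // ltW.
by lra.
Qed.

End Example.

(** * Assembly of the four statements on super-activation *)

Theorem theorem5 (R : realType) :
  (* 1 *)
  (forall A1 A2 : AVWC R,
     C_S A1 = 0%E -> C_S A2 = 0%E ->
     ((0 < C_S (avwc_prod A1 A2))%E <->
        ~ symmetrizable (avwc_prod A1 A2) /\ (0 < C_Sran_mean (avwc_prod A1 A2))%E)) /\
  (forall A1 A2 : AVWC R,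
     superactivates (@C_S R) A1 A2 ->
     C_S (avwc_prod A1 A2) = C_Sran_mean (avwc_prod A1 A2)) /\
  (* 2 *)
  (exists A1 A2 : AVWC R, superactivates (@C_S R) A1 A2) /\
  (* 3 *)
  (forall A1 A2 : AVWC R,
     superactivates (@C_Sran_mean R) A1 A2 ->
     (superactivates (@C_S R) A1 A2 <-> ~ symmetrizable A1 \/ ~ symmetrizable A2)) /\
  (* 4 *)
  (forall A1 A2 : AVWC R,
     ~ superactivates (@C_Sran_mean R) A1 A2 ->
     superactivates (@C_S R) A1 A2 ->
     (~ symmetrizable A1 /\ symmetrizable A2 /\
        C_Sran_mean A1 = 0%E /\ (0 < C_Sran_mean A2)%E) \/
     (~ symmetrizable A2 /\ symmetrizable A1 /\
        C_Sran_mean A2 = 0%E /\ (0 < C_Sran_mean A1)%E)).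
Proof.
have pos_nonsym (A : AVWC R) : (0 < C_S A)%E -> ~ symmetrizable A.
  by move=> pos /sym_C_S C0; rewrite C0 ltxx in pos.
have ran_pos (A : AVWC R) : C_Sran_mean A <> 0%E -> (0 < C_Sran_mean A)%E.
  move=> /eqP ne; rewrite lt_def ne; exact: le_trans (C_S_ge0 A) (C_S_le_C_Sran A).
have part1 (A : AVWC R) :
    (0 < C_S A)%E <-> ~ symmetrizable A /\ (0 < C_Sran_mean A)%E.
  split=> [pos|[nsym]]; last by rewrite nonsym_C_S.
  by split; [exact: pos_nonsym|rewrite -nonsym_C_S //; exact: pos_nonsym].
split; [|split; [|split; [|split]]].
- by move=> A1 A2 _ _; exact: part1.
- by move=> A1 A2 [_ [_ pos]]; apply/nonsym_C_S/pos_nonsym.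
- exists (public_bit R), (adder_channel R); split; first exact: public_bit_C_S.
  split; first exact/sym_C_S/adder_symmetrizable.
  apply/part1; split.
    by move=> /prod_symmetrizable[/public_bit_nonsymmetrizable].
  by apply: lt_le_trans (example_C_Sran R); rewrite lte_fin; lra.
- move=> A1 A2 [ran1 [ran2 ranpos]].
  have zero (A : AVWC R) : C_Sran_mean A = 0%E -> C_S A = 0%E.
    by move=> ran0; apply/eqP; rewrite eq_le C_S_ge0 andbT -ran0 C_S_le_C_Sran.
  split=> [[_ [_ /pos_nonsym nsym]]|nsym].
    by apply/not_andP => sym; apply: nsym; apply/prod_symmetrizable.
  split; [exact: zero|split; [exact: zero|]].
  apply/part1; split=> // /prod_symmetrizable[sym1 sym2].
  by case: nsym.
- move=> A1 A2 nran [C1 [C2 pos]].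
  have [nsym ranpos] := (part1 _).1 pos.
  have nonsym0 (A : AVWC R) : C_S A = 0%E -> ~ symmetrizable A -> C_Sran_mean A = 0%E.
    by move=> C0 /nonsym_C_S <-.
  (* Two symmetrizable factors contradict [nsym]; two nonsymmetrizable ones have zero random-code
     capacity and contradict [nran]. In the mixed cases [nran] forces the symmetrizable factor to
     have positive random-code capacity. *)
  have [sym1|ns1] := pselect (symmetrizable A1); have [sym2|ns2] := pselect (symmetrizable A2).
  + by case: nsym; apply/prod_symmetrizable.
  + right; have ran2 := nonsym0 _ C2 ns2; do 3 split=> //.
    by apply: ran_pos => ran1; apply: nran.
  + left; have ran1 := nonsym0 _ C1 ns1; do 3 split=> //.
    by apply: ran_pos => ran2; apply: nran.
  + by case: nran; split; [exact: nonsym0|split; [exact: nonsym0|]].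
Qed.
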